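(* Let $n\ge1$ and let $\varphi:\mathbb{R}^+\to\mathbb{R}^+\cup\{0\}$ be a $\mathscr{C}^1$ function with $\int_0^\infty\rho^{n-1}\varphi(\rho)\,d\rho<\infty$ and $|\varphi'(\rho)|\le\frac{B}{\rho^{n+1}}$ for some constant $B$ and every $\rho>0$. For each $j\in\mathbb{Z}^+$ let $\varepsilon_j$ be a positive random variable on a probability space $(\Omega,\mathscr{F},\mathscr{P})$, distributed according to $\nu_j$, and let $y_j\equiv\mathbf{0}$. Then the maximal operator $$\mathscr{M}f(x)=\sup_{j\ge1}m_j(|f|)(x)$$ is of weak type $(1,1)$.
   Context: $\mathbb{R}^+=\{t\in\mathbb{R}:t>0\}$, $\mathbb{Z}^+=\{1,2,3,\dots\}$. $\mathscr{E}$ denotes expectation. With $y_j\equiv\mathbf{0}$, for nonnegative measurable $f$ on $\mathbb{R}^n$, $$m_j(f)(x)=\mathscr{E}\left[\frac{1}{\varepsilon_j^n(\omega)}\int_{z\in\mathbb{R}^n}\varphi\left(\frac{|x-z|}{\varepsilon_j(\omega)}\right)f(z)\,dz\right]\in[0,\infty].$$ $\mathscr{M}$ is of weak type $(1,1)$ if there is a constant $A>0$ such that $|\{x\in\mathbb{R}^n:\mathscr{M}f(x)>\lambda\}|\le\frac{A}{\lambda}\|f\|_{L^1(\mathbb{R}^n)}$ for every $\lambda>0$ and every $f\in L^1(\mathbb{R}^n)$, where $|\cdot|$ of a set is Lebesgue measure. *)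

(* Defs.v *)
From HB Require Import structures.
From mathcomp Require Import all_boot all_order all_algebra.
From mathcomp Require Import all_classical all_reals all_analysis.

Set Implicit Arguments.
Unset Strict Implicit.
Unset Printing Implicit Defensive.

Import Order.TTheory GRing.Theory Num.Theory.
Import numFieldNormedType.Exports.

Local Open Scope classical_set_scope.
Local Open Scope ring_scope.
Local Open Scope ereal_scope.

Section tuple_measure.
Context d (T : measurableType d) (R : realType).
Variable m : {sigma_finite_measure set T -> \bar R}.

Definition tuple_cons n (p : T * n.-tuple T) : n.+1.-tuple T :=
  [tuple of p.1 :: p.2].

Lemma measurable_tuple_cons n : measurable_fun setT (@tuple_cons n).
Proof. by apply: measurable_cons. Qed.

Section step.
Context (n : nat) (mu : {sigma_finite_measure set (n.-tuple T) -> \bar R}).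

Definition tuple_measure_step : set (n.+1.-tuple T) -> \bar R :=
  pushforward (m \x mu) (@tuple_cons n).

Let step0 : tuple_measure_step set0 = 0.
Proof. by rewrite /tuple_measure_step /pushforward preimage_set0 measure0. Qed.

Let step_ge0 A : 0 <= tuple_measure_step A.
Proof. exact: (measure_ge0 (m \x mu)). Qed.

Let step_sigma_additive : semi_sigma_additive tuple_measure_step.
Proof.
move=> F mF tF mUF; rewrite /tuple_measure_step /pushforward preimage_bigcup.
have mpre A : measurable A -> measurable (@tuple_cons n @^-1` A).
  by move=> mA; rewrite -[X in measurable X]setTI; exact: measurable_tuple_cons.
apply: measure_semi_sigma_additive.
- by move=> k; exact: mpre.
- apply/trivIsetP => /= i j _ _ ij; rewrite -preimage_setI.
  by move/trivIsetP : tF => /(_ _ _ _ _ ij) ->//; rewrite preimage_set0.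
- by rewrite -preimage_bigcup; exact: mpre.
Qed.

HB.instance Definition _ := isMeasure.Build _ _ _ tuple_measure_step
  step0 step_ge0 step_sigma_additive.

Let step_sigma_finite : sigma_finite setT tuple_measure_step.
Proof.
have [F TF Foo] := sigma_finiteT m.
have [G TG Goo] := sigma_finiteT mu.
have /ppcard_eqP[h] := card_nat2.
pose uncons (t : n.+1.-tuple T) : T * n.-tuple T :=
  (thead t, [tuple of behead t]).
have mu_uncons : measurable_fun setT uncons.
  apply/measurable_fun_pairP; split => /=.
  - exact: measurable_tnth.
  - exact: measurable_behead.
have consK p : uncons (tuple_cons p) = p.
  by case: p => a t; congr pair; apply/val_inj.
pose H k := F (h^-1 k)%FUN.1 `*` G (h^-1 k)%FUN.2.
exists (fun k => uncons @^-1` H k).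
  rewrite -preimage_bigcup (_ : \bigcup_k H k = setT) ?preimage_setT//.
  rewrite -subTset => -[x y] _.
  have [i _ Fi] : (\bigcup_i F i) x by rewrite -TF.
  have [j _ Gj] : (\bigcup_i G i) y by rewrite -TG.
  by exists (h (i, j)) => //; rewrite /H funK ?inE.
move=> k; have [mF oF] := Foo (h^-1 k)%FUN.1.
have [mG oG] := Goo (h^-1 k)%FUN.2.
split.
  rewrite -[X in measurable X]setTI; apply: mu_uncons => //.
  exact: measurableX.
rewrite /tuple_measure_step /pushforward -comp_preimage.
rewrite (_ : uncons \o _ = id); last exact/funext.
by rewrite preimage_id product_measure1E// lte_mul_pinfty// ge0_fin_numE.
Qed.

HB.instance Definition _ := Measure_isSigmaFinite.Build _ _ _ tuple_measure_step
  step_sigma_finite.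

End step.

Fixpoint tuple_measure n : {sigma_finite_measure set (n.-tuple T) -> \bar R} :=
  match n with
  | 0 => \d_ [tuple]
  | k.+1 => tuple_measure_step (tuple_measure k)
  end.

End tuple_measure.

Lemma tuple_measure_box d (T : measurableType d) (R : realType)
    (m : {sigma_finite_measure set T -> \bar R}) n (A : 'I_n -> set T) :
  (forall i, measurable (A i)) ->
  tuple_measure m n [set x | forall i, A i (tnth x i)] = \prod_(i < n) m (A i).
Proof.
elim: n A => [|n IHn] A mA.
  rewrite big_ord0 /= diracE mem_set//= => -[]//.
rewrite big_ord_recl -(IHn (fun i => A (lift ord0 i)))//=.
rewrite /tuple_measure_step /pushforward -product_measure1E//; last first.
  rewrite (_ : mkset _ =
    \bigcap_(i in [set: 'I_n]) ((fun x => tnth x i) @^-1` A (lift ord0 i))).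
    apply: fin_bigcap_measurable => // i _.
    rewrite -[X in measurable X]setTI; apply: measurable_tnth => //.
  by apply/seteqP; split => x /= h i; [move=> _; exact: h|exact: h].
congr (_ \x _); apply/seteqP; split => -[a t] /=.
  move=> h; split; first exact: (h ord0).
  by move=> i; have := h (lift ord0 i); rewrite tnthS.
move=> [Aa h] i; case: (unliftP ord0 i) => [j ->|->] //=.
by rewrite tnthS.
Qed.

Section euclidean_space.
Context {R : realType} (n : nat).

Definition borel_lebesgue :
    {sigma_finite_measure set (n.-tuple (measurableTypeR R)) -> \bar R} :=
  tuple_measure (@lebesgue_measure R) n.

(* The carrier is the type of n-tuples of reals; its measurable sets are the
   Lebesgue-measurable ones, i.e. the Caratheodory sets of the outer measure
   generated by the Borel-Lebesgue measure. *)
Definition Rn : measurableType _ := caratheodory_type (borel_lebesgue^*)%mu.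

Definition lebesgueRn : {measure set Rn -> \bar R} :=
  @completed_measure_extension _ _ R borel_lebesgue.

Lemma borel_lebesgue_measurable (A : set (n.-tuple (measurableTypeR R))) :
  measurable A -> measurable (A : set Rn).
Proof. exact: caratheodory_measurable_mu_ext. Qed.

Lemma lebesgueRnE (A : set (n.-tuple (measurableTypeR R))) :
  measurable A -> lebesgueRn A = borel_lebesgue A.
Proof. exact: measurable_mu_extE. Qed.

Definition coord (x : Rn) (i : 'I_n) : R := tnth (x : n.-tuple R) i.

Definition dist (x y : Rn) : R :=
  Num.sqrt (\sum_(i < n) (coord x i - coord y i) ^+ 2)%R.

(* An operator is applied to a genuine function f with f \in L^1, not to its
   almost-everywhere class. *)
Definition weak_type11 (M : (Rn -> R) -> Rn -> \bar R) : Prop :=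
  exists2 A : R, (0 < A)%R &
    forall lambda : R, (0 < lambda)%R ->
    forall f : Rn -> R, f \in Lfun lebesgueRn 1 ->
      lebesgueRn [set x | lambda%:E < M f x] <=
        (A / lambda)%:E * 'N[lebesgueRn]_1[EFin \o f].

Section averages.
Context d (Omega : measurableType d) (P : probability Omega R).
Variable phi : R -> R.

(* The expectation is an integral with values in [0, +oo], since the inner
   integral may be infinite; the value of phi at 0 plays no role when n > 0, as
   it only occurs at z = x. *)
Definition random_average (eps : Omega -> R) (f : Rn -> R) (x : Rn) : \bar R :=
  \int[P]_w (((eps w) ^- n)%:E *
    \int[lebesgueRn]_z (phi (dist x z / eps w) * f z)%:E).

Definition maximal_operator (eps : nat -> Omega -> R) (f : Rn -> R) (x : Rn) :
    \bar R :=
  ereal_sup [set random_average (eps j) (fun z => `|f z|%R) x |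
             j in [set j | (1 <= j)%N]].

End averages.
End euclidean_space.
Arguments Rn R n : clear implicits.

(* Main.v *)
Require Import Defs.
From HB Require Import structures.
From mathcomp Require Import all_boot all_order all_algebra.
From mathcomp Require Import all_classical all_reals all_analysis.
From mathcomp Require Import measurable_realfun.
From mathcomp Require Import ring lra.

(** The random scales drop out at once. For every x the quantity to bound is an
    expectation of the averages
      T_e f(x) = e^-n * int phi(|x - z| / e) |f(z)| dz,   e = eps_j(w) > 0,
    hence it is at most their supremum over all e > 0, P having mass 1. It
    remains to prove the weak type (1,1) of that supremum, which is a case of
    Zo's maximal theorem: the kernels e^-n phi(|x| / e) have the same L^1 norm
    (bounded by integrating in polar coordinates, [integral_radial_le]), and
    the bound on phi' gives all of them the same modulus of regularity: two
    points z, z' at distance at least d from x satisfy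
      e^-n |phi(|x - z| / e) - phi(|x - z'| / e)| <= n B |z - z'| / d^(n+1)
    with no e on the right-hand side ([kernel_osc_le]).

    Fix a height l proportional to lambda. The stopping cubes Q_i of |f|
    ([calderon_zygmund]) are disjoint, |f| has mean between l and 2^n l on each
    of them, and off their union |f| has mass at most l |q| on every cell q of
    the dyadic grids. Let x lie outside all the dilated cubes.
    - Off the union of the Q_i, the kernel is approximated from below by
      functions that are constant on dyadic cells; on these, |f| dz is
      dominated by l dz, so that this part of T_e f(x) is at most
      l * ||phi||_1 ([integral_good_part_le]). This replaces the usual appeal to
      the Lebesgue differentiation theorem.
    - On Q_i, of side h_i, the kernel is within its oscillation of its mean, so
      that the contribution of Q_i is at most 2^n l times the integral of the
      kernel over Q_i plus 2^n l times a multiple of |Q_i| h_i / |x - c_i|^(n+1)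
      ([integral_bad_cube_le]).
    Altogether T_e f(x) <= 2^n l (2 ||phi||_1 + K S(x)), where S sums the tails
    |Q_i| h_i / |x - c_i|^(n+1), in the dyadic form [dyadic_tail], and does not
    depend on e ([integral_kernel_le_tail]). The choice of l makes the first
    term at most lambda / 2, so that the supremum exceeds lambda only on the
    dilated cubes and where S is larger than a constant. Both sets have measure
    O(sum_i |Q_i|) = O(||f||_1 / lambda), the second one by Chebyshev's
    inequality, since S has integral O(sum_i |Q_i|)
    ([dilation_maximal_weak_type]).

    The superlevel set of the maximal function is measured by its outer measure,
    so that it suffices to cover it by a set of small measure. *)

Set Implicit Arguments.
Unset Strict Implicit.
Unset Printing Implicit Defensive.

Import Order.TTheory GRing.Theory Num.Theory.
Import numFieldNormedType.Exports.

Local Open Scope classical_set_scope.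
Local Open Scope ring_scope.

Local Notation coord := Defs.coord.
Local Notation dist := Defs.dist.

(** * Comparing integrals through countable partitions *)

Lemma measurable_address_preimage (d : measure_display) (T : measurableType d)
    (a : T -> nat) (ma : forall i, measurable [set z | a z = i]) (S : set nat) :
  measurable (a @^-1` S).
Proof.
rewrite (_ : a @^-1` S = \bigcup_(i in S) [set z | a z = i]).
  by apply: bigcup_measurable => i _.
apply/seteqP; split => [z Sz|z [i Si /= azi]]; first by exists (a z).
by rewrite /preimage/= azi.
Qed.

(** The number [a z] of the cell containing z encodes a countable partition, and
    [h (a z)] is the general function that is constant on its cells. *)
Lemma integral_address (d : measure_display) (T : measurableType d)
    (R : realType) (mu : {measure set T -> \bar R}) (D : set T)
    (mD : measurable D) (a : T -> nat)
    (ma : forall i, measurable [set z | a z = i])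
    (h : nat -> \bar R) (h0 : forall i, (0 <= h i)%E)
    (w : T -> R) (w0 : forall z, D z -> 0 <= w z) (mw : measurable_fun D w) :
  (\int[mu]_(z in D) (h (a z) * (w z)%:E) =
   \sum_(0 <= i <oo)
     h i * \int[mu]_(z in D `&` [set z | a z = i]) (w z)%:E)%E.
Proof.
have mDi i : measurable (D `&` [set z | a z = i]) by exact: measurableI.
have DE : D = \bigcup_i (D `&` [set z | a z = i]).
  by apply/seteqP; split => [z Dz|z [i _ []]]//; exists (a z).
have mh : measurable_fun D (h \o a : T -> \bar R).
  move=> _ Y mY; apply: measurableI => //.
  exact: (measurable_address_preimage ma (h @^-1` Y)).
rewrite {1}DE ge0_integral_bigcup//=; last 3 first.
- rewrite -DE; apply: emeasurable_funM => //; exact/measurable_EFinP.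
- by move=> z [i _ [Dz _]]; rewrite mule_ge0 ?lee_fin ?w0.
- by move=> i j _ _ [z [[_ /= <-] [_ /= <-]]].
apply: eq_eseriesr => i _.
rewrite -ge0_integralZl//; last 2 first.
- by apply/measurable_EFinP; apply: measurable_funS mw => // z [].
- by move=> z [Dz _]; rewrite lee_fin w0.
by apply: eq_integral => z; rewrite inE => -[_ /= ->].
Qed.

Lemma le_limn_einf_near (R : realType) (u : (\bar R)^nat) (c : \bar R) :
  (\forall k \near \oo, (c <= u k)%E) -> (c <= limn_einf u)%E.
Proof.
move=> [N _ Nu]; apply: (@le_trans _ _ (einfs u N)).
  by apply: le_ereal_inf_tmp => _ [k /= Nk <-]; exact: Nu.
rewrite limn_einf_lim (cvg_lim _ (@cvg_einfs_sup _ u))//.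
by apply: ereal_sup_ubound; exists N.
Qed.

Lemma measurable_fun_limn_einf (d : measure_display) (T : measurableType d)
    (R : realType) (D : set T) (f : (T -> \bar R)^nat) :
  (forall k, measurable_fun D (f k)) ->
  measurable_fun D (fun x => limn_einf (f^~ x)).
Proof.
move=> mf.
rewrite (_ : (fun x => _) =
    -%E \o (fun x => limn_esup ((fun k y => - f k y)%E^~ x))).
  apply: measurableT_comp; first exact: oppe_measurable.
  by apply: measurable_fun_limn_esup => k; exact: measurableT_comp.
apply/funext => x /=; rewrite -limn_einfN; congr limn_einf.
by apply/funext => k /=; rewrite oppeK.
Qed.

(** If the cells of two sequences of partitions, matched by their numbers,
    always have smaller mass on the left than on the right, then the integral on
    the left of a function G1 that is dominated in the limit by the infima of G2
    over the matching cells is at most the integral of G2 on the right: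
    integrate these infima, which are constant on cells, and conclude by Fatou's
    lemma. It serves once on R^n alone, to use the bounds on the mass of f on
    dyadic cells, and once between R^n and the half-line, as a substitute for
    polar coordinates. *)
Lemma le_integral_address (d1 d2 : measure_display) (T1 : measurableType d1)
    (T2 : measurableType d2) (R : realType)
    (mu1 : {measure set T1 -> \bar R}) (mu2 : {measure set T2 -> \bar R})
    (D1 : set T1) (D2 : set T2) (mD1 : measurable D1) (mD2 : measurable D2)
    (a1 : nat -> T1 -> nat) (a2 : nat -> T2 -> nat)
    (ma1 : forall k i, measurable [set z | a1 k z = i])
    (ma2 : forall k i, measurable [set z | a2 k z = i])
    (w1 G1 : T1 -> R) (w2 G2 : T2 -> R)
    (w10 : forall z, D1 z -> 0 <= w1 z) (w20 : forall z, D2 z -> 0 <= w2 z)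
    (mw1 : measurable_fun D1 w1) (mw2 : measurable_fun D2 w2)
    (G10 : forall z, D1 z -> 0 <= G1 z) (G20 : forall z, 0 <= G2 z)
    (mG1 : measurable_fun D1 G1) (mG2 : measurable_fun D2 G2)
    (w_le : forall k i,
      (\int[mu1]_(z in D1 `&` [set z | a1 k z = i]) (w1 z)%:E <=
       \int[mu2]_(z in D2 `&` [set z | a2 k z = i]) (w2 z)%:E)%E)
    (G_lsc : forall z e, D1 z -> 0 < e -> \forall k \near \oo,
      forall y, D2 y -> a2 k y = a1 k z -> G1 z - e <= G2 y) :
  (\int[mu1]_(z in D1) (G1 z * w1 z)%:E <=
   \int[mu2]_(z in D2) (G2 z * w2 z)%:E)%E.
Proof.
(* h k is the best lower bound for G2 in terms of the cell number at level k *)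
pose h k i := ereal_inf [set (G2 y)%:E | y in D2 `&` [set y | a2 k y = i]].
have h0 k i : (0 <= h k i)%E.
  by apply: le_ereal_inf_tmp => _ [y _ <-]; rewrite lee_fin.
have mh (d : measure_display) (T : measurableType d) (a : nat -> T -> nat)
    (ma : forall k i, measurable [set z | a k z = i]) (D : set T) (w : T -> R)
    k : measurable D -> measurable_fun D w ->
  measurable_fun D (fun z => h k (a k z) * (w z)%:E)%E.
  move=> mD mw; apply: emeasurable_funM; last exact/measurable_EFinP.
  move=> _ Y mY; apply: measurableI => //.
  by rewrite (_ : _ @^-1` _ = a k @^-1` (h k @^-1` Y))//;
    exact: measurable_address_preimage.
pose F k z := (h k (a1 k z) * (w1 z)%:E)%E.
have F0 k z : D1 z -> (0 <= F k z)%E.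
  by move=> D1z; rewrite mule_ge0 ?lee_fin ?w10.
have mF k : measurable_fun D1 (F k) by exact: mh.
have lim_le k : (\int[mu1]_(z in D1) F k z <=
    \int[mu2]_(z in D2) (G2 z * w2 z)%:E)%E.
  rewrite /F integral_address//.
  apply: (@le_trans _ _ (\int[mu2]_(z in D2) (h k (a2 k z) * (w2 z)%:E))%E).
    rewrite integral_address//; apply: lee_nneseries => i _ //.
      rewrite mule_ge0// integral_ge0// => z [D1z _].
      by rewrite lee_fin w10.
    by rewrite lee_wpmul2l.
  apply: ge0_le_integral => //.
  - by move=> z D2z; rewrite mule_ge0 ?lee_fin ?w20.
  - exact: mh.
  - by apply/measurable_EFinP; exact: measurable_funM.
  - move=> z D2z; rewrite EFinM lee_wpmul2r ?lee_fin ?w20//.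
    by apply: ereal_inf_lbound; exists z.
apply: (@le_trans _ _ (\int[mu1]_(z in D1) limn_einf (F^~ z))%E).
  apply: ge0_le_integral => //.
  - by move=> z D1z; rewrite lee_fin mulr_ge0 ?w10 ?G10.
  - by apply/measurable_EFinP; exact: measurable_funM.
  - exact: measurable_fun_limn_einf.
  - move=> z D1z.
    have [w1z0|w1z0] := eqVneq (w1 z) 0.
      rewrite w1z0 mulr0; apply: le_limn_einf_near.
      by near=> k; rewrite F0.
    have {}w1z0 : 0 < w1 z by rewrite lt0r w1z0 w10.
    apply/lee_subgt0Pr => e e0.
    apply: le_limn_einf_near.
    have ew : 0 < e / w1 z by rewrite divr_gt0.
    move: (G_lsc z _ D1z ew); apply: filterS => k Gk.
    rewrite /F -EFinB (_ : _ - e = (G1 z - e / w1 z) * w1 z); last first.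
      by rewrite mulrBl divfK// gt_eqF.
    rewrite EFinM lee_wpmul2r ?lee_fin ?w10//.
    apply: le_ereal_inf_tmp => _ [y [D2y ay] <-]; rewrite lee_fin.
    exact: Gk.
apply: (le_trans (fatou _ mD1 mF F0)).
rewrite limn_einf_lim; apply: lime_le; first exact: is_cvg_einfs.
near=> N; apply: (@le_trans _ _ (\int[mu1]_(z in D1) F N z)%E) => //.
by apply: ereal_inf_lbound; exists N => /=.
Unshelve. all: end_near. Qed.

(** * Affine changes of variables *)

(** Uniqueness theorems for measures are stated for bundled measures; this
    packages the set function that has to be compared with Lebesgue measure. *)
Lemma scaled_pushforward (d1 d2 : measure_display) (T1 : measurableType d1)
    (T2 : measurableType d2) (R : realType) (m : {measure set T1 -> \bar R})
    (f : T1 -> T2) (c : R) :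
  measurable_fun setT f -> 0 <= c ->
  exists nu : {measure set T2 -> \bar R},
    forall A, nu A = (c%:E * m (f @^-1` A))%E.
Proof.
move=> mf c0; unshelve eexists (mscale (NngNum c0) (pushforward m f)) => //.
Qed.

Lemma lebesgue_measure_affine (R : realType) (x r : R) (A : set R) :
  0 < r -> measurable A ->
  (lebesgue_measure ((fun y => (y - x) / r)%R @^-1` A) =
   r%:E * lebesgue_measure A)%E.
Proof.
move=> r0 mA; pose aff (y : measurableTypeR R) := (y - x) / r.
have maff : measurable_fun setT (aff : measurableTypeR R -> measurableTypeR R).
  by apply: measurable_funM => //; exact: measurable_funB.
have rV0 : 0 <= r^-1 by rewrite invr_ge0 ltW.
have [mu muE] := scaled_pushforward lebesgue_measure maff rV0.
have -> : lebesgue_measure A = mu A.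
  apply: lebesgue_measure_unique => // _ [[a b] _ <-]; rewrite muE.
  rewrite (_ : aff @^-1` _ = `](x + a * r), (x + b * r)]%classic); last first.
    by apply/seteqP; split => y /=; rewrite !in_itv/= /aff
      ltr_pdivlMr// ler_pdivrMr// ltrBrDl lerBlDl.
  rewrite /= !lebesgue_measure_itv/= !lte_fin ltrD2l ltr_pM2r//.
  case: ifPn => // _; last by rewrite mule0.
  rewrite -!EFinB -EFinM; congr EFin.
  rewrite opprD addrACA subrr add0r -mulrBl mulrCA mulVf ?mulr1//.
  by rewrite gt_eqF.
by rewrite muE muleA -EFinM divff ?gt_eqF// mul1e.
Qed.

(** The rescaled image of the product measure agrees with the product measure on
    rectangles, hence everywhere. *)
Lemma product_measure_scaling (d1 d2 : measure_display)
    (T1 : measurableType d1) (T2 : measurableType d2) (R : realType)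
    (m1 : {sigma_finite_measure set T1 -> \bar R})
    (m2 : {sigma_finite_measure set T2 -> \bar R})
    (f1 : T1 -> T1) (f2 : T2 -> T2) (c1 c2 : R) :
  measurable_fun setT f1 -> measurable_fun setT f2 -> 0 < c1 -> 0 < c2 ->
  (forall A, measurable A -> m1 (f1 @^-1` A) = (c1%:E * m1 A)%E) ->
  (forall A, measurable A -> m2 (f2 @^-1` A) = (c2%:E * m2 A)%E) ->
  forall X : set (T1 * T2), measurable X ->
    (m1 \x m2)%E ((fun p => (f1 p.1, f2 p.2)) @^-1` X) =
    ((c1 * c2)%:E * (m1 \x m2) X)%E.
Proof.
move=> mf1 mf2 c10 c20 m1E m2E X mX; set f := fun p => _.
have c0 : 0 < c1 * c2 by rewrite mulr_gt0.
have mf : measurable_fun setT f.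
  by apply: measurable_fun_pair; exact: measurableT_comp.
have cV0 : 0 <= (c1 * c2)^-1 by rewrite invr_ge0 ltW.
have [mu muE] := scaled_pushforward (m1 \x m2)%E mf cV0.
rewrite (@product_measure_unique _ _ _ _ _ m1 m2 mu _ _ mX).
  by rewrite muE muleA -EFinM divff ?gt_eqF// mul1e.
move=> A B mA mB; rewrite muE/=.
rewrite (_ : f @^-1` _ = (f1 @^-1` A) `*` (f2 @^-1` B))//.
have mfA : measurable (f1 @^-1` A).
  by rewrite -[X in measurable X]setTI; exact: mf1.
have mfB : measurable (f2 @^-1` B).
  by rewrite -[X in measurable X]setTI; exact: mf2.
rewrite product_measure1E//.
transitivity (((c1 * c2)^-1)%:E * ((c1%:E * m1 A) * (c2%:E * m2 B)))%E.
  by congr (_ * (_ * _))%E; [exact: m1E|exact: m2E].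
rewrite (muleACA c1%:E) -EFinM (muleA (_^-1)%:E) -EFinM.
by rewrite mulVf ?gt_eqF// mul1e.
Qed.

Definition tuple_affine (R : realType) n (x : n.-tuple R) (r : R)
    (y : n.-tuple (measurableTypeR R)) : n.-tuple (measurableTypeR R) :=
  [tuple (tnth y i - tnth x i) / r | i < n].

Lemma measurable_tuple_affine (R : realType) n (x : n.-tuple R) (r : R) :
  measurable_fun setT (tuple_affine x r).
Proof.
apply/measurable_fun_tnthP => i.
rewrite (_ : _ \o _ = fun y => (tnth y i - tnth x i) / r).
  apply: measurable_funM => //; apply: measurable_funB => //.
  exact: measurable_tnth.
by apply/funext => y /=; rewrite /tuple_affine tnth_mktuple.
Qed.

(** Induction on the dimension: the map acts on the head and on the tail of a
    tuple separately. *)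
Lemma borel_lebesgue_affine (R : realType) n (x : n.-tuple R) (r : R)
    (A : set (n.-tuple (measurableTypeR R))) :
  0 < r -> measurable A ->
  borel_lebesgue n (tuple_affine x r @^-1` A) =
  ((r ^+ n)%:E * borel_lebesgue n A)%E.
Proof.
move=> r0; elim: n => [|n IHn] in x A *.
  move=> mA; rewrite expr0 mul1e (_ : tuple_affine x r = id)//.
  by apply/funext => y; apply/eq_from_tnth; case.
move=> mA; rewrite /borel_lebesgue/= /tuple_measure_step /pushforward.
have mcA : measurable (@tuple_cons _ (measurableTypeR R) n @^-1` A).
  by rewrite -[X in measurable X]setTI; exact: measurable_tuple_cons.
pose x' : n.-tuple R := [tuple of behead x].
have mf1 : measurable_fun setT
    (fun y : measurableTypeR R => (y - thead x) / r : measurableTypeR R).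
  by apply: measurable_funM => //; exact: measurable_funB.
have rn0 : 0 < r ^+ n by rewrite exprn_gt0.
have := @product_measure_scaling _ _ (measurableTypeR R)
  (n.-tuple (measurableTypeR R)) R lebesgue_measure (borel_lebesgue n)
  _ (tuple_affine x' r) r (r ^+ n) mf1 (@measurable_tuple_affine R n x' r)
  r0 rn0 _ _ _ mcA.
rewrite exprS => <-; last 2 first.
- by move=> B mB; exact: lebesgue_measure_affine.
- by move=> B mB; exact: IHn.
congr (_ _); apply/seteqP.
suff E p : tuple_affine x r (tuple_cons p) =
    tuple_cons ((p.1 - thead x) / r, tuple_affine x' r p.2).
  by split => p /=; rewrite E.
apply/eq_from_tnth => i; rewrite tnth_mktuple.
case: (unliftP ord0 i) => [j ->|->] /=.
  by rewrite !tnthS tnth_mktuple /x' tnth_behead; congr ((_ - tnth x _) / _);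
    apply/val_inj; rewrite /= inordK// ltnS.
by rewrite !tnth0.
Qed.

(** * Boxes, balls and distances *)

Lemma measurable_coord (R : realType) n (i : 'I_n) :
  measurable_fun setT (fun z : Rn R n => coord z i).
Proof.
move=> _ Y mY; rewrite setTI; apply: borel_lebesgue_measurable.
by rewrite -[X in measurable X]setTI; exact: measurable_tnth.
Qed.

Lemma measurable_dist_borel (R : realType) n (x : Rn R n) :
  measurable_fun setT (dist x : n.-tuple (measurableTypeR R) -> R).
Proof.
apply: measurableT_comp => //.
  exact: (continuous_measurable_fun (@sqrt_continuous R)).
apply: measurable_sum => i; apply: measurable_funX.
by apply: measurable_funB => //; exact: measurable_tnth.
Qed.

Lemma measurable_dist (R : realType) n (x : Rn R n) :
  measurable_fun setT (dist x).
Proof.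
move=> _ Y mY; rewrite setTI; apply: borel_lebesgue_measurable.
by rewrite -[X in measurable X]setTI; exact: measurable_dist_borel.
Qed.

Lemma lebesgueRn_box (R : realType) n (I : 'I_n -> set R) :
  (forall i, measurable (I i)) ->
  lebesgueRn n [set z : Rn R n | forall i, I i (coord z i)] =
  (\prod_(i < n) lebesgue_measure (I i))%E.
Proof.
move=> mI; rewrite -(tuple_measure_box lebesgue_measure mI).
apply: lebesgueRnE.
rewrite (_ : mkset _ = \bigcap_(i in [set: 'I_n])
    ((fun z : n.-tuple (measurableTypeR R) => tnth z i) @^-1` I i)).
  apply: fin_bigcap_measurable => // i _.
  rewrite -[X in measurable X]setTI; apply: measurable_tnth => //; exact: mI.
by apply/seteqP; split => z /= h i; [move=> _; exact: h|exact: h].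
Qed.

(** Half-open, so that the cells of a grid form a partition; the cube of side 0
    is empty in positive dimension, which lets a sequence of cubes have gaps. *)
Definition cube (R : realType) n (c : Rn R n) (h : R) : set (Rn R n) :=
  [set z | forall i, coord z i \in `[coord c i, coord c i + h[%R].

Definition centered_box (R : realType) n (c : Rn R n) (s : R) : set (Rn R n) :=
  [set z | forall i, `|coord z i - coord c i| < s].

Lemma measurable_box (R : realType) n (I : 'I_n -> set R) :
  (forall i, measurable (I i)) ->
  measurable [set z : Rn R n | forall i, I i (coord z i)].
Proof.
move=> mI; rewrite (_ : mkset _ = \bigcap_(i in [set: 'I_n])
    ((fun z : Rn R n => coord z i) @^-1` I i)).
  apply: fin_bigcap_measurable => // i _.
  rewrite -[X in measurable X]setTI; apply: measurable_coord => //; exact: mI.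
by apply/seteqP; split => z /= h i; [move=> _; exact: h|exact: h].
Qed.

Lemma measurable_cube (R : realType) n (c : Rn R n) (h : R) :
  measurable (cube c h).
Proof. by apply: (@measurable_box _ _ (fun i => `[_, _[%classic)). Qed.

Lemma lebesgueRn_cube (R : realType) n (c : Rn R n) (h : R) : 0 <= h ->
  lebesgueRn n (cube c h) = (h ^+ n)%:E.
Proof.
move=> h0; rewrite (@lebesgueRn_box _ _ (fun i => `[_, _[%classic))//.
rewrite (eq_bigr (fun=> h%:E)) => [|i _]; last first.
  rewrite lebesgue_measure_itv/= lte_fin ltrDl.
  by case: ltgtP h0 => // [|<- _//]; rewrite -EFinB addrAC subrr add0r.
by rewrite prodEFin big_const_ord iter_mulr_1.
Qed.

Lemma centered_boxE (R : realType) n (c : Rn R n) (s : R) :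
  centered_box c s = [set z | forall i,
    `](coord c i - s), (coord c i + s)[%classic (coord z i)].
Proof.
by apply/seteqP; split => z /= H i; move: (H i); rewrite /= in_itv/= ltr_distl.
Qed.

Lemma measurable_centered_box (R : realType) n (c : Rn R n) (s : R) :
  measurable (centered_box c s).
Proof.
rewrite centered_boxE.
exact: (@measurable_box _ _ (fun i => `]_, _[%classic)).
Qed.

Lemma lebesgueRn_centered_box (R : realType) n (c : Rn R n) (s : R) : 0 <= s ->
  lebesgueRn n (centered_box c s) = ((2 * s) ^+ n)%:E.
Proof.
move=> s0; rewrite centered_boxE.
rewrite (@lebesgueRn_box _ _ (fun i => `]_, _[%classic))//.
rewrite (eq_bigr (fun=> (2 * s)%:E)) => [|i _]; last first.
  rewrite lebesgue_measure_itv/= lte_fin ltrD2l -subr_gt0 opprK -mulr2n.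
  rewrite pmulrn_lgt0//; case: ltgtP s0 => // [s0 _|<- _]; last first.
    by rewrite mulr0.
  by rewrite -EFinB; congr EFin; ring.
by rewrite prodEFin big_const_ord iter_mulr_1.
Qed.

Lemma le_coord_dist (R : realType) n (x z : Rn R n) i :
  `|coord x i - coord z i| <= dist x z.
Proof.
rewrite -sqrtr_sqr ler_sqrt ?sumr_ge0//; last by move=> j _; exact: sqr_ge0.
by rewrite (bigD1 i)//= lerDl sumr_ge0// => j _; exact: sqr_ge0.
Qed.

Lemma dist_ge0 (R : realType) n (x z : Rn R n) : 0 <= dist x z.
Proof. exact: sqrtr_ge0. Qed.

Lemma dist_eq0 (R : realType) n (x z : Rn R n) : dist x z = 0 -> x = z.
Proof.
move=> xz0; apply: (@eq_from_tnth n R x z) => i; apply/eqP.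
by rewrite -subr_eq0 -normr_le0 -xz0; exact: le_coord_dist.
Qed.

(** The difference of two Euclidean norms is the difference of their squares
    divided by their sum, and the difference of the squares is a sum of products
    of which one factor is at most s and the other at most the sum of the norms.
    The constant n is not sharp, but it spares the triangle inequality. *)
Lemma le_dist_sub (R : realType) n (x z z' : Rn R n) (s : R) :
  (forall i, `|coord z i - coord z' i| <= s) ->
  `|dist x z - dist x z'| <= n%:R * s.
Proof.
move=> zz'.
have [n0|n0] := posnP n.
  move: x z z' zz'; rewrite n0 => x z z' _.
  by rewrite /dist !big_ord0 subrr normr0 mul0r.
have s0 : 0 <= s by apply: le_trans (zz' (Ordinal n0)).
have d0 := dist_ge0 x z; have d'0 := dist_ge0 x z'.
have [dd0|dd0] := leP (dist x z + dist x z') 0.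
  rewrite (_ : dist x z - dist x z' = 0) ?normr0 ?mulr_ge0//.
  by apply/eqP; rewrite subr_eq0 eq_le; apply/andP; split; lra.
rewrite -(ler_pM2r dd0) -{1}(gtr0_norm dd0) -normrM -subr_sqr.
rewrite !sqr_sqrtr ?sumr_ge0//; try by move=> j _; exact: sqr_ge0.
rewrite -sumrB (le_trans (ler_norm_sum _ _ _))//.
have -> : n%:R * s * (dist x z + dist x z') =
    \sum_(i < n) s * (dist x z + dist x z').
  by rewrite -mulrA sumr_const card_ord mulr_natl.
apply: ler_sum => i _.
rewrite subr_sqr normrM; apply: ler_pM => //.
  rewrite (_ : _ - _ = coord z' i - coord z i); last by ring.
  by rewrite distrC.
by rewrite (le_trans (ler_normD _ _))// lerD// le_coord_dist.
Qed.

Definition origin (R : realType) n : Rn R n := [tuple (0 : R) | i < n].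

Lemma measurable_dist_lt (R : realType) n (x : Rn R n) (r : R) :
  measurable [set z | dist x z < r].
Proof.
rewrite (_ : mkset _ = dist x @^-1` `]-oo, r[%classic).
  by rewrite -[X in measurable X]setTI; exact: measurable_dist.
by apply/seteqP; split => z /=; rewrite in_itv.
Qed.

Definition ball_volume (R : realType) n : R :=
  fine (lebesgueRn n [set z | dist (origin R n) z < 1]).

Lemma ball_volume_fin (R : realType) n :
  lebesgueRn n [set z | dist (origin R n) z < 1] = (ball_volume R n)%:E.
Proof.
rewrite /ball_volume fineK// ge0_fin_numE//.
apply: (@le_lt_trans _ _ (lebesgueRn n (centered_box (origin R n) 1))).
  apply: le_measure; rewrite ?inE.
  - exact: measurable_dist_lt.
  - exact: measurable_centered_box.
  - by move=> z /= z1 i; rewrite distrC (le_lt_trans (le_coord_dist _ _ _)).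
by rewrite lebesgueRn_centered_box// ltry.
Qed.

Lemma ball_volume_ge0 (R : realType) n : 0 <= ball_volume R n.
Proof. by rewrite -lee_fin -ball_volume_fin. Qed.

(** The ball is the preimage of the unit ball under an affine map. *)
Lemma lebesgueRn_ball (R : realType) n (x : Rn R n) (r : R) : 0 <= r ->
  (0 < n)%N ->
  lebesgueRn n [set z | dist x z < r] = (ball_volume R n * r ^+ n)%:E.
Proof.
move=> r0 n0; move: r0; rewrite le_eqVlt => /predU1P[<-|r0].
  rewrite expr0n gtn_eqF//= mulr0 (_ : mkset _ = set0) ?measure0//.
  by rewrite -subset0 => z /=; rewrite ltNge dist_ge0.
have mB : measurable ([set z | dist (origin R n) z < 1] :
    set (n.-tuple (measurableTypeR R))).
  rewrite (_ : mkset _ = dist (origin R n) @^-1` `]-oo, 1[%classic).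
    by rewrite -[X in measurable X]setTI; exact: measurable_dist_borel.
  by apply/seteqP; split => z /=; rewrite in_itv.
have -> : [set z | dist x z < r] =
    tuple_affine x r @^-1` [set z | dist (origin R n) z < 1].
  suff E z : dist (origin R n) (tuple_affine x r z) = dist x z / r.
    by apply/seteqP; split => z /=; rewrite E ltr_pdivrMr// mul1r.
  rewrite /Defs.dist -[X in _ / X](gtr0_norm r0) -sqrtr_sqr.
  rewrite -sqrtrV ?sqr_ge0// -sqrtrM ?sumr_ge0//; last first.
    by move=> i _; exact: sqr_ge0.
  congr Num.sqrt; rewrite mulr_suml; apply: eq_bigr => i _.
  rewrite /Defs.coord !tnth_mktuple sub0r sqrrN expr_div_n; congr (_ / _).
  by rewrite -sqrrN opprB.
rewrite lebesgueRnE; last first.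
  by rewrite -[X in measurable X]setTI; exact: measurable_tuple_affine.
rewrite borel_lebesgue_affine// mulrC EFinM; congr (_ * _)%E.
by rewrite -ball_volume_fin lebesgueRnE.
Qed.

Lemma lebesgueRn_shell (R : realType) n (x : Rn R n) (a b : R) :
  (0 < n)%N -> 0 <= a -> a <= b ->
  lebesgueRn n [set z | a <= dist x z < b] =
  (ball_volume R n * (b ^+ n - a ^+ n))%:E.
Proof.
move=> n0 a0 ab; have b0 := le_trans a0 ab.
rewrite (_ : mkset _ = [set z | dist x z < b] `\` [set z | dist x z < a]).
  rewrite measureD; try exact: measurable_dist_lt.
    rewrite setIidr; last by move=> z /= /lt_le_trans; apply.
    rewrite [X in (X - _)%E](lebesgueRn_ball x b0 n0).
    by rewrite [X in (_ - X)%E](lebesgueRn_ball x a0 n0) -EFinB -mulrBr.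
  by rewrite [X in (X < _)%E](lebesgueRn_ball x b0 n0) ltry.
apply/seteqP; split => z /=.
  by move=> /andP[az zb]; split => //; apply/negP; rewrite -leNgt.
by move=> [zb /negP]; rewrite -leNgt => az; apply/andP.
Qed.

(** * Integrals of radial functions *)

Lemma near_exp2V_lt (R : realType) (e : R) : 0 < e ->
  \forall k \near \oo, (2 ^+ k)^-1 < e.
Proof.
move=> e0; exists (Num.truncn e^-1).+1 => // k /= Nk.
rewrite invf_plt ?posrE ?exprn_gt0//.
apply: (lt_le_trans (truncnS_gt _)); rewrite -natrX ler_nat.
by rewrite (leq_trans Nk)// ltnW// ltn_expl.
Qed.

Lemma measurable_truncn_eq (d : measure_display) (T : measurableType d)
    (R : realType) (f : T -> R) (i : nat) :
  measurable_fun setT f -> (forall z, 0 <= f z) ->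
  measurable [set z | Num.truncn (f z) = i].
Proof.
move=> mf f0; rewrite (_ : mkset _ = f @^-1` `[i%:R, i.+1%:R[%classic).
  by rewrite -[X in measurable X]setTI; exact: mf.
by apply/seteqP; split => z /=; rewrite in_itv/= -truncn_eq// => /eqP.
Qed.

Lemma integral_expn (R : realType) (n : nat) (a b : R) : (0 < n)%N -> a <= b ->
  (\int[lebesgue_measure]_(t in `]a, b[) (n%:R * t ^+ n.-1)%:E =
   (b ^+ n - a ^+ n)%:E)%E.
Proof.
move=> n0; rewrite le_eqVlt => /predU1P[->|ab].
  by rewrite set_itvoo0 integral_set0 subrr.
have cX m : continuous (fun t : R => t ^+ m) by exact: exprn_continuous.
have cf : continuous (fun t : R => n%:R * t ^+ n.-1).
  by move=> t; apply: cvgMr; exact: cX.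
rewrite -(@integral_itv_bndoo _ _ _ _ true false); last first.
  apply/measurable_EFinP/measurable_funTS; exact: continuous_measurable_fun.
rewrite (@continuous_FTC2 _ _ (fun t => t ^+ n))//.
- exact: continuous_subspaceT.
- split => //.
  + by move=> t _; exact: exprn_derivable.
  + by apply: cvg_at_right_filter; exact: cX.
  + by apply: cvg_at_left_filter; exact: cX.
- by move=> t _; rewrite derive1E exp_derive -mulr_natl scaler1.
Qed.

(** One half of integration in polar coordinates. The spherical shell with radii
    e a <= e b has measure V e^n (b^n - a^n) = int_a^b n V e^n t^(n-1) dt, where
    V is the volume of the unit ball, so that the shells of thickness e / 2^k
    can be compared with the dyadic intervals of the half-line. *)
Lemma integral_radial_le (R : realType) (n : nat) (n0 : (0 < n)%N)
    (psi : R -> R) (psi_ge0 : forall t, 0 <= psi t) (psi0 : psi 0 = 0)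
    (psi_cont : forall t, 0 < t -> {for t, continuous psi})
    (mpsi : measurable_fun setT psi) (x : Rn R n) (e : R) (e0 : 0 < e) :
  (\int[lebesgueRn n]_z (psi (dist x z / e))%:E <=
   (n%:R * ball_volume R n * e ^+ n)%:E *
   \int[lebesgue_measure]_(t in `]0%R, +oo[) (t ^+ n.-1 * psi t)%:E)%E.
Proof.
have V0 := ball_volume_ge0 R n.
pose C := ball_volume R n * e ^+ n.
have C0 : 0 <= C by rewrite mulr_ge0// exprn_ge0// ltW.
have mD : measurable (`]0%R, +oo[%classic : set (measurableTypeR R)) by [].
have mX m : measurable_fun setT (fun t : measurableTypeR R => t ^+ m).
  by apply: continuous_measurable_fun; exact: exprn_continuous.
rewrite (_ : (n%:R * _ * _) = C * n%:R); last by rewrite /C; ring.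
rewrite -ge0_integralZl//; first last.
- by rewrite lee_fin mulr_ge0.
- move=> t /=; rewrite in_itv/= andbT => t0.
  by rewrite lee_fin mulr_ge0// exprn_ge0// ltW.
- by apply/measurable_EFinP/measurable_funTS; exact: measurable_funM.
under [leRHS]eq_integral do rewrite -EFinM mulrA [_ * psi _]mulrC.
under eq_integral do rewrite -[psi _]mulr1.
have mdist : measurable_fun setT (fun z => dist x z / e).
  exact: (measurable_funM (measurable_dist x) (measurable_cst _)).
have de0 z : 0 <= dist x z / e by rewrite divr_ge0// ?dist_ge0// ltW.
(* the shell of level k containing z and the interval containing t = |x - z| / e
   have the same number *)
pose a1 (k : nat) (z : Rn R n) := Num.truncn (2 ^+ k * (dist x z / e)).
pose a2 (k : nat) (t : measurableTypeR R) := Num.truncn (2 ^+ k * `|t|).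
have p2 k : 0 < 2 ^+ k :> R by rewrite exprn_gt0.
have p2e k : 0 < 2 ^+ k / e :> R by rewrite divr_gt0.
have a1_ge0 k z : 0 <= 2 ^+ k * (dist x z / e) by rewrite mulr_ge0// ltW.
have a2_ge0 k (t : R) : 0 <= 2 ^+ k * `|t| by rewrite mulr_ge0// ltW.
have ma1 k i : measurable [set z | a1 k z = i].
  apply: measurable_truncn_eq (a1_ge0 k).
  exact: (measurable_funM (measurable_cst _) mdist).
have ma2 k i : measurable [set t | a2 k t = i].
  apply: measurable_truncn_eq (a2_ge0 k).
  by apply: measurable_funM => //; exact: measurableT_comp.
have weight_ge0 t : `]0%R, +oo[%classic t -> 0 <= C * n%:R * t ^+ n.-1.
  rewrite /= in_itv/= andbT => t0.
  by apply: mulr_ge0; [exact: mulr_ge0|exact: exprn_ge0 (ltW t0)].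
have mweight D : measurable_fun D
    (fun t : measurableTypeR R => C * n%:R * t ^+ n.-1).
  by apply: measurable_funTS; exact: measurable_funM.
have m1 : measurable_fun setT (fun _ : Rn R n => 1 : R).
  exact: measurable_cst.
have mk : measurable_fun setT (fun z => psi (dist x z / e)).
  exact: (measurableT_comp mpsi mdist).
apply: (@le_integral_address _ _ _ _ R (lebesgueRn n) lebesgue_measure _ _
  measurableT mD a1 a2 ma1 ma2 (fun=> 1) (fun z => psi (dist x z / e)) _ psi
  _ weight_ge0 m1 (mweight _) _ psi_ge0 mk
  (measurable_funTS mpsi)).
- by move=> z _; exact: ler01.
- by move=> z _; exact: psi_ge0.
- move=> k i; rewrite setTI.
  rewrite integral_cst ?mul1e; last exact: ma1.
  have -> : [set z | a1 k z = i] =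
      [set z | i%:R / (2 ^+ k / e) <= dist x z < i.+1%:R / (2 ^+ k / e)].
    suff E z : (a1 k z == i) =
        (i%:R / (2 ^+ k / e) <= dist x z < i.+1%:R / (2 ^+ k / e)).
      apply/seteqP; split => z /=; first by move=> /eqP; rewrite E.
      by rewrite -E => /eqP.
    rewrite /a1 truncn_eq; last exact: a1_ge0.
    by rewrite ler_pdivrMr// ltr_pdivlMr// mulrCA.
  pose a := i%:R / 2 ^+ k : R; pose b := i.+1%:R / 2 ^+ k : R.
  have ab : a <= b by rewrite ler_pM2r ?invr_gt0// ler_nat.
  have a0 : 0 <= a by rewrite divr_ge0// ltW.
  have aE j : j / (2 ^+ k / e) = j / 2 ^+ k * e.
    by rewrite invf_div [e / _]mulrC mulrA.
  have ae0 : 0 <= a * e by rewrite mulr_ge0// ltW.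
  have abe : a * e <= b * e by exact: ler_wpM2r (ltW e0) _ _ ab.
  rewrite !aE -/a -/b lebesgueRn_shell//.
  rewrite (_ : _ * _ = C * (b ^+ n - a ^+ n)); last first.
    by rewrite !exprMn /C; ring.
  have ab0 t : `]a, b[%classic t -> 0 < t.
    by rewrite /= in_itv/= => /andP[/(le_lt_trans a0)].
  rewrite EFinM -integral_expn// -ge0_integralZl//; last 2 first.
  + by apply/measurable_EFinP/measurable_funTS; exact: measurable_funM.
  + move=> t /ab0 t0; rewrite lee_fin.
    by apply: mulr_ge0 => //; exact: exprn_ge0 (ltW t0).
  under eq_integral do rewrite -EFinM mulrA.
  apply: ge0_subset_integral => //.
  + exact: (measurableI _ _ mD (ma2 k i)).
  + by apply/measurable_EFinP; exact: mweight.
  + by move=> t [t0 _]; rewrite lee_fin weight_ge0.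
  + move=> t abt; have t0 := ab0 _ abt; split => /=.
      by rewrite in_itv/= t0.
    move: abt; rewrite /= in_itv/= => /andP[at1 tb].
    apply/eqP; rewrite /a2 truncn_eq; last exact: a2_ge0.
    rewrite gtr0_norm// mulrC -ler_pdivrMr// -ltr_pdivlMr// (ltW at1).
    exact: tb.
- move=> z d _ d0.
  have := de0 z; rewrite le_eqVlt => /predU1P[z0|z0].
    near=> k => t _ _; rewrite -z0 psi0 sub0r.
    by rewrite (@le_trans _ _ 0)// oppr_le0 ltW.
  have /cvgrPdist_lt /(_ _ d0) [/= r r0 near_z] := psi_cont _ z0.
  have := near_exp2V_lt r0; apply: filterS => k kr t /=.
  rewrite in_itv/= andbT => t0 /eqP; rewrite /a2 truncn_eq; last first.
    exact: a2_ge0.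
  have := truncn_itv (a1_ge0 k z).
  rewrite -/(a1 k z) gtr0_norm// -[(a1 k z).+1%:R]natr1.
  move=> /andP[z1 z2] /andP[t1 t2].
  have tz : `|dist x z / e - t| < r.
    apply: (lt_trans _ kr); rewrite -[ltRHS]mul1r ltr_pdivlMr//.
    rewrite -[X in _ * X](gtr0_norm (p2 k)) -normrM mulrBl ltr_norml.
    rewrite ![_ * 2 ^+ k]mulrC; apply/andP; split; lra.
  have := near_z t tz; rewrite ltr_norml => /andP[_].
  by rewrite ltrBlDr -ltrBlDl => /ltW.
Unshelve. all: end_near. Qed.

(** * The Calderon-Zygmund stopping cubes *)

Lemma floor_eqP (R : archiRealFieldType) (t : R) (q : int) :
  Num.floor t = q <-> q%:~R <= t < (q + 1)%:~R.
Proof.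
split=> [<-|]; first exact: floor_itv.
exact: floor_def.
Qed.

(** Dyadic grids are nested. *)
Lemma eq_floor_double (R : archiRealFieldType) (u v : R) :
  Num.floor (2 * u) = Num.floor (2 * v) -> Num.floor u = Num.floor v.
Proof.
move=> uv; apply/esym/floor_eqP; set a := Num.floor u.
have /andP[au ua] := floor_itv u; rewrite -/a in au ua.
have h1 : (2 * a)%:~R <= 2 * u by rewrite intrM ler_pM2l.
have h2 : 2 * u < (2 * (a + 1))%:~R by rewrite intrM ltr_pM2l.
move: h1 h2; rewrite -floor_ge_int -floor_lt_int uv floor_ge_int floor_lt_int.
by rewrite !intrM ler_pM2l// ltr_pM2l// => -> ->.
Qed.

Definition grid_index (R : realType) n (h : R) (z : Rn R n) :
    {ffun 'I_n -> int} :=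
  [ffun i => Num.floor (coord z i / h)].

Definition grid_corner (R : realType) n (h : R) (q : {ffun 'I_n -> int}) :
    Rn R n :=
  [tuple (q i)%:~R * h | i < n].

Lemma grid_cellE (R : realType) n (h : R) (q : {ffun 'I_n -> int}) : 0 < h ->
  [set z : Rn R n | grid_index h z = q] = cube (grid_corner h q) h.
Proof.
move=> h0; apply/seteqP; split => z /=.
  move=> <- i; rewrite in_itv/= /Defs.coord tnth_mktuple ffunE.
  have /andP[] := floor_itv (coord z i / h).
  rewrite ler_pdivlMr// ltr_pdivrMr// intrD mulrDl mul1r.
  by rewrite /Defs.coord => -> ->.
move=> zq; apply/ffunP => i; rewrite ffunE; apply/floor_eqP.
have := zq i; rewrite in_itv/= /Defs.coord tnth_mktuple.
by rewrite ler_pdivlMr// ltr_pdivrMr// intrD mulrDl mul1r.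
Qed.

Lemma grid_index_corner (R : realType) n (h : R) (q : {ffun 'I_n -> int}) :
  0 < h -> grid_index h (grid_corner h q : Rn R n) = q.
Proof.
move=> h0; apply/ffunP => i; rewrite ffunE /Defs.coord tnth_mktuple.
by rewrite mulfK ?gt_eqF// intrKfloor.
Qed.

Lemma grid_index_half (R : realType) n (h : R) (y z : Rn R n) :
  grid_index (h / 2) y = grid_index (h / 2) z ->
  grid_index h y = grid_index h z.
Proof.
move=> yz; apply/ffunP => i; rewrite !ffunE; apply: eq_floor_double.
have half t : t / (h / 2) = 2 * (t / h) by rewrite invf_div mulrCA.
by have := congr1 (fun g : {ffun _ -> _} => g i) yz; rewrite !ffunE !half.
Qed.

Lemma grid_index_close (R : realType) n (h : R) (y z : Rn R n) : 0 < h ->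
  grid_index h y = grid_index h z -> forall i, `|coord y i - coord z i| <= h.
Proof.
move=> h0 yz i; have := congr1 (fun g : {ffun _ -> _} => g i) yz.
rewrite !ffunE => /floor_eqP; set q := Num.floor _; rewrite intrD.
have := floor_itv (coord z i / h); rewrite -/q intrD.
rewrite !ler_pdivlMr// !ltr_pdivrMr// => /andP[z1 z2] /andP[y1 y2].
by rewrite ler_norml; apply/andP; split; lra.
Qed.

(** The stopping cubes Q i of f at height l, in a dyadic grid of mesh s / 2^k,
    k >= 0. A cell is bad when the mean of f over it exceeds l, and Q i runs
    over the bad cells all of whose ancestors are good; the ancestor one level
    up gives the factor 2^n. A point outside all the Q i lies in good cells
    only, which gives the last conclusion: there [a k z] numbers the cell of
    level k containing z. *)
Lemma calderon_zygmund (R : realType) n (n0 : (0 < n)%N) (f : Rn R n -> R)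
    (f0 : forall z, 0 <= f z) (mf : measurable_fun setT f)
    (f_fin : (\int[lebesgueRn n]_z (f z)%:E < +oo)%E) (l : R) (l0 : 0 < l) :
  exists (c : nat -> Rn R n) (h : nat -> R) (s : R) (a : nat -> Rn R n -> nat),
  let Q i := cube (c i) (h i) in
  [/\ (forall i, 0 <= h i) /\ trivIset setT Q,
      forall i, ((l * h i ^+ n)%:E <= \int[lebesgueRn n]_(z in Q i) (f z)%:E <=
                (2 ^+ n * l * h i ^+ n)%:E)%E,
      0 < s /\ forall k j, measurable [set z | a k z = j],
      forall k y z, a k y = a k z ->
        forall i, `|coord y i - coord z i| <= s / 2 ^+ k &
      forall k j, (\int[lebesgueRn n]_(z in
            ~` (\bigcup_i Q i) `&` [set z | a k z = j]) (f z)%:E <=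
          l%:E * lebesgueRn n [set z | a k z = j])%E ].
Proof.
have mfE D : measurable_fun D (EFin \o f).
  exact/measurable_EFinP/measurable_funTS.
pose I := fine (\int[lebesgueRn n]_z (f z)%:E).
have I0 : 0 <= I by rewrite fine_ge0// integral_ge0// => z _; rewrite lee_fin.
have IE : (\int[lebesgueRn n]_z (f z)%:E)%E = I%:E.
  rewrite /I fineK// ge0_fin_numE// integral_ge0// => z _; rewrite lee_fin//.
(* at this mesh the mean of f over any cell is at most I / s^n <= l *)
pose s := 1 + I / l.
have s1 : 1 <= s by rewrite lerDl divr_ge0// ltW.
have s0 : 0 < s by exact: lt_le_trans s1.
pose h k : R := s / 2 ^+ k.
have h0 k : 0 < h k by rewrite divr_gt0// exprn_gt0.
have hS k : h k.+1 = h k / 2 by rewrite /h exprSr invfM mulrA.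
pose gi k (z : Rn R n) := grid_index (h k) z.
pose cell k q := [set z : Rn R n | gi k z = q].
have cellE k q : cell k q = cube (grid_corner (h k) q) (h k).
  exact: grid_cellE.
have mcell k q : measurable (cell k q).
  by rewrite cellE; exact: measurable_cube.
have gi_le j k y z : (j <= k)%N -> gi k y = gi k z -> gi j y = gi j z.
  move=> /subnK <-; elim: (k - j)%N => [//|m IHm].
  by rewrite addSn /gi hS => /grid_index_half; exact: IHm.
pose bad k q := ((l * h k ^+ n)%:E <
  \int[lebesgueRn n]_(z in cell k q) (f z)%:E)%E.
have bad0 q : ~~ bad 0%N q.
  rewrite -leNgt (@le_trans _ _ I%:E)//.
    rewrite -IE; apply: ge0_subset_integral => //.
    by move=> z _; rewrite lee_fin.
  rewrite lee_fin /h expr0 divr1 (@le_trans _ _ (l * s))//.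
    by rewrite mulrDr mulr1 mulrCA divff ?gt_eqF// mulr1 lerDr ltW.
  by rewrite ler_pM2l// -[leLHS]expr1 ler_weXn2l.
pose stop k z := bad k (gi k z) && [forall j : 'I_k, ~~ bad j (gi j z)].
have stop_eq k y z : gi k y = gi k z -> stop k y = stop k z.
  move=> yz; rewrite /stop yz; congr (_ && _); apply: eq_forallb => j.
  by rewrite (gi_le _ _ _ _ (ltnW (ltn_ord j)) yz).
have stop_uniq k m z : stop k z -> stop m z -> k = m.
  move=> /andP[bk /forallP gk] /andP[bm /forallP gm].
  have [km|mk|//] := ltngtP k m.
    by have := gm (Ordinal km); rewrite /= bk.
  by have := gk (Ordinal mk); rewrite /= bm.
(* The stopping cells are enumerated by decoding i as a level and a cell; the
   other codes yield the empty cube. *)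
pose idx (i : nat) : option (nat * {ffun 'I_n -> int}) :=
  if pickle_inv i is Some (k, q) then
    if stop k (grid_corner (h k) q) then Some (k, q) else None
  else None.
pose c i : Rn R n :=
  if idx i is Some (k, q) then grid_corner (h k) q else origin R n.
pose hh i : R := if idx i is Some (k, q) then h k else 0.
have QE i : cube (c i) (hh i) = if idx i is Some (k, q) then cell k q else set0.
  rewrite /c /hh; case: (idx i) => [[k q]|]; first by rewrite cellE.
  rewrite -subset0 => z /(_ (Ordinal n0)) /=; rewrite addr0 in_itv/=.
  by case: ltgtP.
have idxP i k q z : idx i = Some (k, q) -> cell k q z ->
    stop k z /\ pickle (k, q) = i.
  rewrite /idx; case E : (pickle_inv i) => [[k' q']|//].
  case: ifPn => // st [<- <-] zq; split; last first.
    by have := @pickle_invK (nat * {ffun 'I_n -> int})%type i; rewrite E.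
  rewrite (stop_eq _ _ (grid_corner (h k') q'))//.
  by rewrite /gi grid_index_corner.
exists c, hh, s, (fun k z => pickle (gi k z)) => /=; split.
- split.
    by move=> i; rewrite /hh; case: (idx i) => [[k q]|//]; exact: ltW.
  move=> i j _ _ [z []]; rewrite !QE.
  case Ei : (idx i) => [[k q]|//] zi; case Ej : (idx j) => [[k' q']|//] zj.
  have [st <-] := idxP _ _ _ _ Ei zi; have [st' <-] := idxP _ _ _ _ Ej zj.
  have kk := stop_uniq _ _ _ st st'; move: zi zj; rewrite /cell/= => <-.
  by rewrite kk => <-.
- move=> i; rewrite QE /hh; case Ei : (idx i) => [[k q]|]; last first.
    by rewrite expr0n gtn_eqF//= !mulr0 integral_set0 lexx.
  have cq : cell k q (grid_corner (h k) q).
    by rewrite /cell/= /gi grid_index_corner.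
  have [/andP[bk /forallP gk] _] := idxP _ _ _ _ Ei cq.
  rewrite cq in bk; rewrite ltW//=.
  case: k => [|k] in Ei cq bk gk *; first by rewrite (negPf (bad0 _)) in bk.
  have := gk (ord_max); rewrite /= -leNgt; set q' := gi k _ => gkE.
  apply: le_trans.
    apply: (@ge0_subset_integral _ _ _ _ _ (cell k q')) => //.
    + by move=> z _; rewrite lee_fin.
    + move=> z zq; apply: (gi_le _ k.+1) => //.
      by move: zq cq; rewrite /cell/= => -> ->.
  apply: (le_trans gkE); rewrite lee_fin hS.
  rewrite (_ : 2 ^+ n * l * _ = l * h k ^+ n)//.
  rewrite [2 ^+ n * l]mulrC -mulrA; congr (_ * _).
  by rewrite [h k / 2]mulrC exprMn exprVn mulVKf// expf_neq0.
- split => // k j.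
  have [[q <-]|nq] := pselect (exists q : {ffun 'I_n -> int}, pickle q = j).
    rewrite (_ : mkset _ = cell k q)//; apply/seteqP; split => z /=.
      exact: (pcan_inj pickleK).
    by rewrite /cell/= => ->.
  rewrite (_ : mkset _ = set0)// -subset0 => z /= zj.
  by apply: nq; exists (gi k z).
- by move=> k y z /(pcan_inj pickleK) yz; exact: grid_index_close (h0 k) yz.
- move=> k j; set F := ~` _.
  have [[z Fz zj]|Fj0] := pselect (exists2 z, F z & pickle (gi k z) = j);
    last first.
    rewrite (_ : F `&` _ = set0) ?integral_set0 ?mule_ge0 ?lee_fin ?(ltW l0)//.
    by rewrite -subset0 => z [Fz /= zj]; apply: Fj0; exists z.
  have -> : [set z | pickle (gi k z) = j] = cell k (gi k z).
    apply/seteqP; split => y /=; rewrite -zj; first exact: (pcan_inj pickleK).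
    by rewrite /cell/= => ->.
  have gz : ~~ bad k (gi k z).
    apply/negP => bk; apply: Fz.
    have exk : exists k, bad k (gi k z) by exists k.
    pose m := ex_minn exk.
    have stm : stop m z.
      rewrite /m; case: ex_minnP => m' bm' minm'; rewrite /stop bm'/=.
      apply/forallP => j'; apply/negP => /minm'.
      by rewrite leqNgt ltn_ord.
    exists (pickle (m, gi m z)) => //; rewrite QE /idx pickleK_inv.
    by rewrite (stop_eq _ _ z) ?stm// /gi grid_index_corner.
  rewrite /bad -leNgt in gz.
  apply: (@le_trans _ _ (\int[lebesgueRn n]_(y in cell k (gi k z)) (f y)%:E)%E).
    apply: ge0_subset_integral => //.
    + apply: measurableI => //; apply: measurableC.
      by apply: bigcup_measurable => i _; exact: measurable_cube.
    + by move=> y _; rewrite lee_fin.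
  apply: (le_trans gz).
  by rewrite cellE lebesgueRn_cube ?(ltW (h0 k))// -EFinM.
Qed.

(** * Oscillation and decay away from a cube *)

(** Bound g z on the left by g z' + D, and average the resulting inequality over
    z' in Q. *)
Lemma integral_oscillation_le (d : measure_display) (T : measurableType d)
    (R : realType) (mu : {measure set T -> \bar R}) (Q : set T)
    (mQ : measurable Q) (v : R) (v0 : 0 < v) (muQ : mu Q = v%:E)
    (f g : T -> R) (f0 : forall z, 0 <= f z) (g0 : forall z, 0 <= g z)
    (mf : measurable_fun setT f) (mg : measurable_fun setT g)
    (D M : R) (D0 : 0 <= D) (M0 : 0 <= M)
    (osc : forall z z', Q z -> Q z' -> g z <= g z' + D)
    (f_le : (\int[mu]_(z in Q) (f z)%:E <= (M * v)%:E)%E) :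
  (\int[mu]_(z in Q) (g z * f z)%:E <=
   M%:E * (\int[mu]_(z in Q) (g z)%:E + (D * v)%:E))%E.
Proof.
have mfQ : measurable_fun Q (EFin \o f).
  exact/measurable_EFinP/measurable_funTS.
have mgQ : measurable_fun Q (EFin \o g).
  exact/measurable_EFinP/measurable_funTS.
set J := (\int[mu]_(z in Q) (g z * f z)%:E)%E.
have J_le z' : Q z' -> (J <= M%:E * v%:E * ((g z')%:E + D%:E))%E.
  move=> Qz'; apply: (@le_trans _ _
      (\int[mu]_(z in Q) (((g z' + D)%:E * (f z)%:E)))%E).
    apply: ge0_le_integral => //.
    - by move=> z _; rewrite lee_fin mulr_ge0.
    - by apply/measurable_EFinP/measurable_funTS; exact: measurable_funM.
    - exact: measurable_funeM.
    - by move=> z Qz; rewrite -EFinM lee_fin ler_wpM2r// osc.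
  rewrite ge0_integralZl//; last 2 first.
  - by move=> z _; rewrite lee_fin.
  - by rewrite lee_fin addr_ge0.
  rewrite -EFinD -[X in (_ <= X * _)%E]EFinM [leRHS]muleC lee_wpmul2l//.
  by rewrite lee_fin addr_ge0.
rewrite -(@lee_pmul2r _ v%:E)// ?ltry ?lte_fin//.
rewrite -muQ -integral_cst// muQ.
apply: (@le_trans _ _ (\int[mu]_(z in Q) (M%:E * v%:E * ((g z)%:E + D%:E)))%E).
  apply: ge0_le_integral => //.
  - by move=> z _; apply: integral_ge0 => y _; rewrite lee_fin mulr_ge0.
  - by apply: measurable_funeM; exact: emeasurable_funD.
rewrite ge0_integralZl//; last 3 first.
- exact: emeasurable_funD.
- by move=> z _; rewrite -EFinD lee_fin addr_ge0.
- by rewrite -EFinM lee_fin mulr_ge0// ltW.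
rewrite ge0_integralD//; try by move=> z _; rewrite lee_fin.
by rewrite integral_cst// muQ -EFinM muleAC.
Qed.

(** Comparable with (h / |x - c|)^(n+1) when x is at distance at least h from c.
    As a sum of indicators of boxes it is integrated by summing a geometric
    series. *)
Definition dyadic_tail (R : realType) n (c : Rn R n) (h : R) (x : Rn R n) :
    \bar R :=
  (\sum_(0 <= m <oo)
    ((2 ^+ (m * n.+1))^-1 * \1_(centered_box c (2 ^+ m.+1 * h)) x)%:E)%E.

Lemma dyadic_tail_ge0 (R : realType) n (c : Rn R n) (h : R) (x : Rn R n) :
  (0 <= dyadic_tail c h x)%E.
Proof.
by apply: nneseries_ge0 => m _ _; rewrite lee_fin mulr_ge0// invr_ge0 exprn_ge0.
Qed.

Lemma measurable_dyadic_tail_term (R : realType) n (c : Rn R n) (h : R) m :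
  measurable_fun setT (fun x : Rn R n =>
    ((2 ^+ (m * n.+1))^-1 * \1_(centered_box c (2 ^+ m.+1 * h)) x : R)%:E).
Proof.
apply/measurable_EFinP; apply: (measurable_funM (measurable_cst _)).
exact: (measurable_indic (measurable_centered_box _ _)).
Qed.

Lemma measurable_dyadic_tail (R : realType) n (c : Rn R n) (h : R) :
  measurable_fun setT (dyadic_tail c h).
Proof.
apply: ge0_emeasurable_sum => m.
  by move=> x _ _; rewrite lee_fin mulr_ge0// invr_ge0 exprn_ge0.
by move=> _; exact: measurable_dyadic_tail_term.
Qed.

Lemma integral_dyadic_tail (R : realType) n (c : Rn R n) (h : R) : 0 <= h ->
  (\int[lebesgueRn n]_x dyadic_tail c h x = (2 * 4 ^+ n * h ^+ n)%:E)%E.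
Proof.
move=> h0; rewrite /dyadic_tail.
have term_ge0 m (x : Rn R n) : [set: Rn R n] x -> (0 <=
    ((2 ^+ (m * n.+1))^-1 * \1_(centered_box c (2 ^+ m.+1 * h)) x : R)%:E)%E.
  by move=> _; rewrite lee_fin mulr_ge0// invr_ge0 exprn_ge0.
rewrite (integral_nneseries (lebesgueRn n) measurableT
  (measurable_dyadic_tail_term c h) term_ge0).
transitivity (\sum_(0 <= m <oo)
    (2 * 4 ^+ n * h ^+ n / (2 ^ m.+1)%:R)%:E : \bar R)%E.
  apply: eq_eseriesr => m _.
  under eq_integral do rewrite EFinM.
  have mI : measurable_fun setT
      (fun x => (\1_(centered_box c (2 ^+ m.+1 * h)) x)%:E : \bar R).
    apply/measurable_EFinP.
    exact: (measurable_indic (measurable_centered_box _ _)).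
  rewrite (ge0_integralZl (lebesgueRn n) measurableT mI); last 2 first.
  - by move=> x _; rewrite lee_fin.
  - by rewrite lee_fin invr_ge0 exprn_ge0.
  rewrite integral_indic//; last exact: measurable_centered_box.
  rewrite setIT lebesgueRn_centered_box ?mulr_ge0// -EFinM; congr EFin.
  rewrite natrX mulnS exprD exprM exprS.
  rewrite (_ : 2 * (2 * 2 ^+ m * h) = 4 * 2 ^+ m * h); last by ring.
  rewrite !exprMn; set u := 2 ^+ m; have u0 : u != 0 by rewrite expf_neq0.
  by field; rewrite u0 expf_neq0.
under eq_eseriesr => m _ do rewrite -[m.+1]addn1.
rewrite -[X in _ = X%:E]divr1 -[X in _ / X](expr0 2).
by apply: cvg_lim => //; exact: cvg_geometric_eseries_half.
Qed.

(** With the sup norm, m is the scale such that 2^m h <= |x - c| < 2^(m+1) h. *)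
Lemma dyadic_scale_off_box (R : realType) n (c x : Rn R n) (h : R) :
  0 < h -> ~ centered_box c (2 * h) x ->
  exists2 m, ((2 ^+ (m * n.+1))^-1%:E <= dyadic_tail c h x)%E &
    forall z, cube c h z -> 2 ^+ m * h / 2 <= dist x z.
Proof.
move=> h0 xc.
have exm : exists m, `[< centered_box c (2 ^+ m.+1 * h) x >].
  pose N := \sum_(i < n) `|coord x i - coord c i|.
  have [k kN] : exists k, N / h < 2 ^+ k.
    exists (Num.truncn (N / h)).+1; apply: (lt_le_trans (truncnS_gt _)).
    by rewrite -natrX ler_nat ltnW// ltn_expl.
  exists k; apply/asboolP => i; apply: (@le_lt_trans _ _ N).
    by rewrite /N (bigD1 i)//= lerDl sumr_ge0.
  by rewrite -ltr_pdivrMr// (lt_trans kN)// ltr_eXn2l// ltr1n.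
case: (ex_minnP exm) => m /asboolP xm minm.
have m0 : (0 < m)%N.
  by case: m => [|//] in xm minm *; rewrite expr1 in xm.
have /existsNP[i /negP] : ~ centered_box c (2 ^+ m * h) x.
  move=> xm'; have := minm m.-1; rewrite prednK// => /(_ (asboolT xm')).
  by rewrite -ltnS prednK// ltnn.
rewrite -leNgt => xi; exists m.
  rewrite /dyadic_tail (@nneseriesD1 _ _ m)//.
  rewrite indicE mem_set// mulr1 leeDl//.
  apply: nneseries_ge0 => j _ _.
  by rewrite lee_fin mulr_ge0// invr_ge0 exprn_ge0.
move=> z /(_ i); rewrite in_itv/= => /andP[cz zc].
apply: (le_trans _ (le_coord_dist x z i)).
have h2 : h <= 2 ^+ m * h / 2.
  rewrite ler_pdivlMr// mulrC ler_pM2r// -[leLHS]expr1 ler_weXn2l// ler1n//.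
have zci : `|coord z i - coord c i| <= h.
  by rewrite ler_norml; apply/andP; split; lra.
have := ler_normD (coord x i - coord z i) (coord z i - coord c i).
rewrite addrA subrK => tri; lra.
Qed.

(** * Dilates of the kernel against the good and the bad part *)

(** What the proof uses of phi. The last clause is the mean value form of the
    bound B / t^(n+1) on the derivative, and the value 0 at the origin makes
    the profile lower semicontinuous there. *)
Definition kernel_profile (R : realType) (n : nat) (B : R) (psi : R -> R) :
    Prop :=
  [/\ forall t, 0 <= psi t, psi 0 = 0,
      forall t, 0 < t -> {for t, continuous psi},
      measurable_fun setT psi &
      forall s t, 0 < s -> s <= t ->
        `|psi s - psi t| <= B * (t - s) / s ^+ n.+1].

Lemma measurable_kernel (R : realType) n (psi : R -> R) (x : Rn R n) (e : R) :
  measurable_fun setT psi ->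
  measurable_fun setT (fun z => psi (dist x z / e)).
Proof.
move=> mpsi; apply: (measurableT_comp mpsi).
exact: (measurable_funM (measurable_dist x) (measurable_cst _)).
Qed.

(** Homogeneity: a bound of degree -(n+1) for the derivative of psi turns into a
    bound for the kernel psi(|x| / e) / e^n that does not depend on e. *)
Lemma kernel_osc_le (R : realType) n (B : R) (psi : R -> R) (B0 : 0 <= B)
    (psiP : kernel_profile n B psi) (x z z' : Rn R n) (e d h : R) :
  0 < e -> 0 < d -> d <= dist x z -> d <= dist x z' ->
  (forall i, `|coord z i - coord z' i| <= h) ->
  psi (dist x z / e) <=
    psi (dist x z' / e) + e ^+ n * (B * (n%:R * h) / d ^+ n.+1).
Proof.
case: psiP => _ _ _ _ psi_lip e0 d0 dz dz' zz'.
have dist_zz' := le_dist_sub x zz'.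
rewrite addrC -lerBlDr.
wlog suff H : / forall s t, d <= s -> s <= t -> `|s - t| <= n%:R * h ->
    `|psi (s / e) - psi (t / e)| <= e ^+ n * (B * (n%:R * h) / d ^+ n.+1).
  apply: (le_trans (ler_norm _)).
  have [zz|zz] := leP (dist x z) (dist x z'); first exact: H.
  by rewrite distrC; apply: H => //; [exact: ltW|rewrite distrC].
move=> s t ds st st_le.
have s0 : 0 < s by exact: lt_le_trans ds.
apply: (le_trans (psi_lip _ _ _ _)); first by rewrite divr_gt0.
  by rewrite ler_pM2r ?invr_gt0.
rewrite -mulrBl.
have -> : B * ((t - s) / e) / (s / e) ^+ n.+1 =
    e ^+ n * (B * (t - s) / s ^+ n.+1).
  rewrite expr_div_n invf_div [e ^+ n.+1]exprS.
  by field; rewrite ?gt_eqF ?exprn_gt0.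
rewrite ler_wpM2l ?exprn_ge0 ?(ltW e0)//.
apply: ler_pM.
- by rewrite mulr_ge0// subr_ge0.
- by rewrite invr_ge0 exprn_ge0// ltW.
- by rewrite ler_wpM2l// (le_trans _ st_le)// distrC ler_norm.
- by rewrite lef_pV2 ?posrE ?exprn_gt0// lerXn2r// nnegrE ltW.
Qed.

(** The measure f dz restricted to F is dominated by l dz on every cell of every
    grid, and the kernel is the limit of its infima over the cells: it is
    continuous except at z = x, where it takes its least value 0. *)
Lemma integral_good_part_le (R : realType) n (B : R) (psi : R -> R)
    (psiP : kernel_profile n B psi) (f : Rn R n -> R)
    (f0 : forall z, 0 <= f z) (mf : measurable_fun setT f)
    (l s : R) (l0 : 0 <= l) (s0 : 0 < s) (a : nat -> Rn R n -> nat)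
    (F : set (Rn R n))
    (mF : measurable F) (ma : forall k j, measurable [set z | a k z = j])
    (a_close : forall k y z, a k y = a k z ->
        forall i, `|coord y i - coord z i| <= s / 2 ^+ k)
    (f_le : forall k j, (\int[lebesgueRn n]_(z in F `&` [set z | a k z = j])
          (f z)%:E <= l%:E * lebesgueRn n [set z | a k z = j])%E)
    (x : Rn R n) (e : R) (e0 : 0 < e) :
  (\int[lebesgueRn n]_(z in F) (psi (dist x z / e) * f z)%:E <=
   l%:E * \int[lebesgueRn n]_z (psi (dist x z / e))%:E)%E.
Proof.
case: (psiP) => psi_ge0 psi0 psi_cont mpsi _.
have mk := measurable_kernel x e mpsi.
have mkE : measurable_fun setT (fun z => (psi (dist x z / e))%:E).
  by apply/measurable_EFinP; exact: mk.
have ml : measurable_fun setT (fun _ : Rn R n => l) by exact: measurable_cst.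
rewrite -(ge0_integralZl (lebesgueRn n) measurableT mkE); last 2 first.
- by move=> z _; rewrite lee_fin.
- by rewrite lee_fin.
under [leRHS]eq_integral do rewrite -EFinM mulrC.
apply: (@le_integral_address _ _ _ _ R (lebesgueRn n) (lebesgueRn n) _ _
  mF measurableT a a ma ma f (fun z => psi (dist x z / e)) (fun=> l)
  (fun z => psi (dist x z / e)) _ _ (measurable_funTS mf) ml _ _
  (measurable_funTS mk) mk).
- by move=> z _; exact: f0.
- by move=> z _; exact: l0.
- by move=> z _; exact: psi_ge0.
- by move=> z; exact: psi_ge0.
- move=> k j; apply: (le_trans (f_le k j)).
  by rewrite setTI integral_cst.
- move=> z d Fz d0.
  have := dist_ge0 x z; rewrite le_eqVlt => /predU1P[z0|z0].
    near=> k => y _ _; rewrite -z0 mul0r psi0 sub0r.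
    by rewrite (@le_trans _ _ 0)// oppr_le0 ltW.
  have z0' : 0 < dist x z / e by rewrite divr_gt0.
  have /cvgrPdist_lt /(_ _ d0) [/= r r0 near_z] := psi_cont _ z0'.
  have r'0 : 0 < r * e / (n%:R * s + 1).
    by rewrite !divr_gt0 ?mulr_gt0 ?ltr_wpDl ?mulr_ge0 ?(ltW s0).
  have := near_exp2V_lt r'0; apply: filterS => k kr y _ /a_close yz.
  have := le_dist_sub x yz => xyz.
  have tz : `|dist x z / e - dist x y / e| < r.
    rewrite -mulrBl normrM (gtr0_norm (_ : 0 < e^-1)) ?invr_gt0// ltr_pdivrMr//.
    rewrite distrC (le_lt_trans xyz)// mulrA.
    move: kr; rewrite ltr_pdivlMr ?ltr_wpDl ?mulr_ge0 ?(ltW s0)//.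
    move=> /(le_lt_trans _); apply.
    by rewrite mulrC ler_wpM2l ?invr_ge0 ?exprn_ge0// lerDl.
  have := near_z _ tz; rewrite ltr_norml => /andP[_].
  by rewrite ltrBlDr -ltrBlDl => /ltW.
Unshelve. all: end_near. Qed.

(** If |x - c| is of the order of 2^m h, then x is at distance at least
    2^m h / 2 from the whole cube, and the oscillation of psi(|x - z| / e) over
    the cube is at most e^n * (n B 2^(n+1)) * 2^-(m (n+1)) / h^n. *)
Lemma integral_bad_cube_le (R : realType) n (n0 : (0 < n)%N) (B : R)
    (psi : R -> R) (B0 : 0 <= B) (psiP : kernel_profile n B psi)
    (f : Rn R n -> R) (f0 : forall z, 0 <= f z) (mf : measurable_fun setT f)
    (M : R) (M0 : 0 <= M) (c : Rn R n) (h : R) (h0 : 0 <= h)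
    (f_le : (\int[lebesgueRn n]_(z in cube c h) (f z)%:E <= (M * h ^+ n)%:E)%E)
    (x : Rn R n) (xc : ~ centered_box c (2 * h) x) (e : R) (e0 : 0 < e) :
  (\int[lebesgueRn n]_(z in cube c h) (psi (dist x z / e) * f z)%:E <=
   M%:E * (\int[lebesgueRn n]_(z in cube c h) (psi (dist x z / e))%:E +
     (e ^+ n * (B * n%:R * 2 ^+ n.+1))%:E * dyadic_tail c h x))%E.
Proof.
case: (psiP) => psi_ge0 _ _ mpsi _.
have mk := measurable_kernel x e mpsi.
move: h0; rewrite le_eqVlt => /predU1P[h0|h0].
  rewrite (_ : cube c h = set0); last first.
    rewrite -subset0 => z /(_ (Ordinal n0)) /=; rewrite -h0 addr0 in_itv/=.
    by case: ltgtP.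
  rewrite !integral_set0 add0e mule_ge0 ?lee_fin// mule_ge0 ?dyadic_tail_ge0//.
  by rewrite lee_fin !mulr_ge0 ?exprn_ge0// ltW.
have [m mtail md] := dyadic_scale_off_box h0 xc.
pose d := 2 ^+ m * h / 2; have d0 : 0 < d by rewrite !mulr_gt0 ?exprn_gt0.
pose D := e ^+ n * (B * (n%:R * h) / d ^+ n.+1).
have D0 : 0 <= D.
  by rewrite !mulr_ge0 ?invr_ge0 ?exprn_ge0// ltW.
have osc z z' : cube c h z -> cube c h z' ->
    psi (dist x z / e) <= psi (dist x z' / e) + D.
  move=> Qz Qz'; apply: (kernel_osc_le B0 psiP e0 d0); [exact: md|exact: md|].
  move=> i; have := Qz i; have := Qz' i.
  rewrite !in_itv/= => /andP[? ?] /andP[? ?].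
  by rewrite ler_norml; apply/andP; split; lra.
have hn0 : 0 < h ^+ n by rewrite exprn_gt0.
apply: le_trans (integral_oscillation_le (measurable_cube c h) hn0
  (lebesgueRn_cube c (ltW h0)) f0 _ mf mk D0 M0 osc f_le) _ => //.
rewrite lee_wpmul2l ?lee_fin// leeD2l//.
have -> : D * h ^+ n = e ^+ n * (B * n%:R * 2 ^+ n.+1) * (2 ^+ (m * n.+1))^-1.
  rewrite /D /d !exprMn exprVn exprM [h ^+ n.+1]exprS.
  set u := (2 ^+ m) ^+ n.+1; set v := 2 ^+ n.+1; set w := h ^+ n.
  have u0 : u != 0 by rewrite !expf_neq0.
  have v0 : v != 0 by rewrite expf_neq0.
  have w0 : w != 0 by rewrite gt_eqF.
  by field; rewrite u0 v0 w0 gt_eqF.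
rewrite EFinM lee_wpmul2l//.
by rewrite lee_fin !mulr_ge0 ?exprn_ge0// ltW.
Qed.

Lemma integral_kernel_le_tail (R : realType) n (n0 : (0 < n)%N) (B : R)
    (psi : R -> R) (B0 : 0 <= B) (psiP : kernel_profile n B psi)
    (f : Rn R n -> R) (f0 : forall z, 0 <= f z) (mf : measurable_fun setT f)
    (l : R) (l0 : 0 <= l) (c : nat -> Rn R n) (h : nat -> R) (s : R)
    (a : nat -> Rn R n -> nat) (h0 : forall i, 0 <= h i)
    (disjQ : trivIset setT (fun i => cube (c i) (h i)))
    (Q_le : forall i, (\int[lebesgueRn n]_(z in cube (c i) (h i)) (f z)%:E <=
                (2 ^+ n * l * h i ^+ n)%:E)%E)
    (s0 : 0 < s) (ma : forall k j, measurable [set z | a k z = j])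
    (a_close : forall k y z, a k y = a k z ->
        forall i, `|coord y i - coord z i| <= s / 2 ^+ k)
    (F_le : forall k j, (\int[lebesgueRn n]_(z in
            ~` (\bigcup_i cube (c i) (h i)) `&` [set z | a k z = j])
          (f z)%:E <= l%:E * lebesgueRn n [set z | a k z = j])%E)
    (x : Rn R n) (e : R) (e0 : 0 < e)
    (xc : forall i, ~ centered_box (c i) (2 * h i) x) :
  (\int[lebesgueRn n]_z (psi (dist x z / e) * f z)%:E <=
   (2 ^+ n * l)%:E * (2%:E * \int[lebesgueRn n]_z (psi (dist x z / e))%:E +
     (e ^+ n * (B * n%:R * 2 ^+ n.+1))%:E *
     \sum_(0 <= i <oo) dyadic_tail (c i) (h i) x))%E.
Proof.
case: (psiP) => psi_ge0 _ _ mpsi _.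
have mk := measurable_kernel x e mpsi.
set M := 2 ^+ n * l; set K := e ^+ n * _; set O := \bigcup_i _ in F_le.
have M0 : 0 <= M by rewrite mulr_ge0// exprn_ge0.
have K0 : 0 <= K by rewrite !mulr_ge0 ?exprn_ge0// ltW.
have mQ i : measurable (cube (c i) (h i)) by exact: measurable_cube.
have mO : measurable O by exact: bigcup_measurable.
have mkE D : measurable_fun D (fun z => (psi (dist x z / e))%:E).
  exact/measurable_EFinP/measurable_funTS.
have mkfE D : measurable_fun D (fun z => (psi (dist x z / e) * f z)%:E).
  by apply/measurable_EFinP/measurable_funTS; exact: measurable_funM.
have kf0 z : (0 <= (psi (dist x z / e) * f z)%:E)%E by rewrite lee_fin mulr_ge0.
have k0 z : (0 <= (psi (dist x z / e))%:E)%E by rewrite lee_fin.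
rewrite -[in leLHS](setvU O) ge0_integral_setU//; last 2 first.
- exact: measurableC.
- by rewrite disj_set2E setICl.
have S0 : (0 <= \sum_(0 <= i <oo) dyadic_tail (c i) (h i) x)%E.
  by apply: nneseries_ge0 => i _ _; exact: dyadic_tail_ge0.
have k_ge0 D : (0 <= \int[lebesgueRn n]_(z in D) (psi (dist x z / e))%:E)%E.
  exact: integral_ge0.
have split2 (p q : \bar R) : (0 <= p -> 0 <= q ->
    M%:E * (2%:E * p + q) = M%:E * p + M%:E * (p + q))%E.
  move=> p0 q0; rewrite -ge0_muleDr//; last exact: adde_ge0.
  by rewrite addeA; congr (_ * (_ + _))%E; rewrite mule_natl mule2n.
rewrite split2 ?mule_ge0//.
apply: leeD.
  apply: (le_trans (integral_good_part_le psiP f0 mf l0 s0 (measurableC mO)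
    ma a_close F_le x e0)).
  rewrite lee_wpmul2r ?integral_ge0// lee_fin /M ler_peMl// exprn_ege1//.
  by rewrite ler1n.
rewrite ge0_integral_bigcup//.
apply: (@le_trans _ _ (\sum_(0 <= i <oo) (M%:E *
    (\int[lebesgueRn n]_(z in cube (c i) (h i)) (psi (dist x z / e))%:E +
     K%:E * dyadic_tail (c i) (h i) x)))%E).
  apply: lee_nneseries => [i _ _|i _]; first by rewrite integral_ge0.
  exact: integral_bad_cube_le.
rewrite nneseriesZl; last first.
  move=> i _; rewrite adde_ge0 ?integral_ge0// mule_ge0//.
  exact: dyadic_tail_ge0.
rewrite lee_wpmul2l// nneseriesD//; last first.
  by move=> i _ _; rewrite mule_ge0//; exact: dyadic_tail_ge0.
rewrite nneseriesZl; last by move=> i _; exact: dyadic_tail_ge0.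
rewrite leeD2r// -ge0_integral_bigcup//.
exact: ge0_subset_integral.
Qed.

Lemma chebyshev_ge (d : measure_display) (T : measurableType d) (R : realType)
    (mu : {measure set T -> \bar R}) (g : T -> \bar R) (t : R) :
  (forall x, (0 <= g x)%E) -> measurable_fun setT g -> 0 < t ->
  (mu [set x | (t%:E <= g x)%E] <= (t^-1)%:E * \int[mu]_x g x)%E.
Proof.
move=> g0 mg t0; set S := mkset _.
have mS : measurable S.
  by rewrite -[S]setTI; exact: emeasurable_fun_c_infty.
rewrite muleC lee_pdivlMr// muleC -integral_cst//.
apply: (@le_trans _ _ (\int[mu]_(x in S) g x)%E).
  apply: ge0_le_integral => //; first by move=> x _; rewrite lee_fin ltW.
  exact: measurable_funTS.
exact: ge0_subset_integral.
Qed.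

(** Weak type (1,1) for the supremum over all scales, in the form of an
    exceptional set U that works for every scale at once. *)
Lemma dilation_maximal_weak_type (R : realType) n (n0 : (0 < n)%N) (B C : R)
    (psi : R -> R) (B0 : 0 <= B) (C0 : 0 <= C) (psiP : kernel_profile n B psi)
    (psi_int : forall (x : Rn R n) (e : R), 0 < e ->
      (\int[lebesgueRn n]_z (psi (dist x z / e))%:E <= (C * e ^+ n)%:E)%E) :
  exists2 A : R, 0 < A & forall (lambda : R) (f : Rn R n -> R), 0 < lambda ->
    (forall z, 0 <= f z) -> measurable_fun setT f ->
    (\int[lebesgueRn n]_z (f z)%:E < +oo)%E ->
    exists2 U : set (Rn R n),
      (lebesgueRn n U <= (A / lambda)%:E * \int[lebesgueRn n]_z (f z)%:E)%E &
      forall x e, ~ U x -> 0 < e ->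
        ((e ^- n)%:E * \int[lebesgueRn n]_z (psi (dist x z / e) * f z)%:E <=
         lambda%:E)%E.
Proof.
pose K := B * n%:R * 2 ^+ n.+1.
have K0 : 0 <= K by rewrite !mulr_ge0 ?exprn_ge0.
(* With l = lambda / E, the bound 2^n l (2 C + K S x) is at most lambda as soon
   as S x < t: then K S x <= 2 (C + 1), and 2^n l * 4 (C + 1) = lambda. *)
pose t := 2 * (C + 1) / (K + 1).
have t0 : 0 < t by rewrite divr_gt0 ?mulr_gt0 ?ltr_wpDl.
pose E := 2 ^+ n.+2 * (C + 1).
have E0 : 0 < E by rewrite mulr_gt0 ?exprn_gt0 ?ltr_wpDl.
(* the share of the dilated cubes, of side 4 h i, plus that of Chebyshev's
   inequality *)
pose A0 := 4 ^+ n + t^-1 * (2 * 4 ^+ n).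
have A00 : 0 < A0.
  by rewrite addr_gt0 ?exprn_gt0 ?mulr_gt0 ?invr_gt0 ?exprn_gt0.
exists (A0 * E); first exact: mulr_gt0.
move=> lambda f lambda0 f0 mf f_fin.
pose l := lambda / E; have l0 : 0 < l by rewrite divr_gt0.
have [c [h [s [a]]]] := calderon_zygmund n0 f0 mf f_fin l0.
move=> [[h0 disjQ] Q_le [s0 ma] a_close F_le].
pose S x := (\sum_(0 <= i <oo) dyadic_tail (c i) (h i) x)%E.
have S0 x : (0 <= S x)%E.
  by apply: nneseries_ge0 => i _ _; exact: dyadic_tail_ge0.
have mS : measurable_fun setT S.
  apply: ge0_emeasurable_sum => i *; first exact: dyadic_tail_ge0.
  exact: measurable_dyadic_tail.
pose U1 := \bigcup_i centered_box (c i) (2 * h i).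
pose U2 := [set x | (t%:E <= S x)%E].
have mf' D : measurable_fun D (EFin \o f).
  exact/measurable_EFinP/measurable_funTS.
have sum_h : (\sum_(0 <= i <oo) (h i ^+ n)%:E <=
    (l^-1)%:E * \int[lebesgueRn n]_z (f z)%:E)%E.
  rewrite muleC lee_pdivlMr// muleC -nneseriesZl; last first.
    by move=> i _; rewrite lee_fin exprn_ge0.
  apply: (@le_trans _ _ (\sum_(0 <= i <oo)
      \int[lebesgueRn n]_(z in cube (c i) (h i)) (f z)%:E)%E).
    apply: lee_nneseries => i _; last by have /andP[] := Q_le i.
    by move=> _; rewrite lee_fin mulr_ge0 ?exprn_ge0// ltW.
  have mQ i : measurable (cube (c i) (h i)) by exact: measurable_cube.
  have f0E z : (0 <= (f z)%:E)%E by rewrite lee_fin.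
  have mO := bigcup_measurable (fun i (_ : [set: nat] i) => mQ i).
  rewrite -ge0_integral_bigcup//.
  exact: ge0_subset_integral.
exists (U1 `|` U2).
  have mU1 : measurable U1.
    by apply: bigcup_measurable => i _; exact: measurable_centered_box.
  have mU2 : measurable U2.
    by rewrite -[U2]setTI; exact: emeasurable_fun_c_infty.
  apply: (le_trans (measureU2 _ _ _)) => //.
  apply: (@le_trans _ _ (A0%:E * \sum_(0 <= i <oo) (h i ^+ n)%:E)%E);
    last first.
    rewrite (_ : A0 * E / lambda = A0 * l^-1); last first.
      by rewrite /l invf_div [RHS]mulrA.
    by rewrite EFinM -muleA lee_wpmul2l// lee_fin ltW.
  rewrite /A0 EFinD ge0_muleDl; last 2 first.
  - by rewrite lee_fin exprn_ge0.
  - rewrite lee_fin; apply: mulr_ge0; first by rewrite invr_ge0 ltW.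
    by rewrite mulr_ge0 ?exprn_ge0.
  apply: leeD.
    apply: (le_trans (measure_sigma_subadditive _ _ mU1 (@subset_refl _ _))).
      by move=> i; exact: measurable_centered_box.
    rewrite -nneseriesZl; last by move=> i _; rewrite lee_fin exprn_ge0.
    apply: lee_nneseries => // i _.
    rewrite lebesgueRn_centered_box ?mulr_ge0// -EFinM lee_fin -exprMn.
    by rewrite mulrA -natrM.
  apply: (le_trans (chebyshev_ge _ S0 mS t0)).
  rewrite EFinM -muleA lee_wpmul2l// ?lee_fin ?invr_ge0 ?(ltW t0)//.
  have -> : (\int[lebesgueRn n]_x S x = \sum_(0 <= i <oo)
      \int[lebesgueRn n]_x dyadic_tail (c i) (h i) x)%E.
    exact: (integral_nneseries _ measurableT
      (fun i => measurable_dyadic_tail (c i) (h i))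
      (fun i x _ => dyadic_tail_ge0 (c i) (h i) x)).
  rewrite -nneseriesZl; last by move=> i _; rewrite lee_fin exprn_ge0.
  apply: lee_nneseries => [i _ _|i _].
    by rewrite integral_ge0// => x _; exact: dyadic_tail_ge0.
  by rewrite integral_dyadic_tail// -EFinM.
move=> x e /not_orP[xU1 /negP xU2] e0.
have xc i : ~ centered_box (c i) (2 * h i) x by move=> xi; apply: xU1; exists i.
have Q_le' i : (\int[lebesgueRn n]_(z in cube (c i) (h i)) (f z)%:E <=
    (2 ^+ n * l * h i ^+ n)%:E)%E by have /andP[] := Q_le i.
have e_gt0 : 0 < e ^+ n by rewrite exprn_gt0.
rewrite -ltNge in xU2.
rewrite muleC lee_pdivrMr//.
apply: (le_trans (integral_kernel_le_tail n0 B0 psiP f0 mf (ltW l0) h0 disjQ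
  Q_le' s0 ma a_close F_le e0 xc)).
apply: (@le_trans _ _ ((2 ^+ n * l)%:E * (2%:E * (C * e ^+ n)%:E +
    (e ^+ n * K)%:E * t%:E))%E).
  apply: lee_wpmul2l; first by rewrite lee_fin mulr_ge0 ?exprn_ge0// ltW.
  apply: leeD; first by apply: lee_wpmul2l; [rewrite lee_fin|exact: psi_int].
  by rewrite lee_wpmul2l ?(ltW xU2)// lee_fin mulr_ge0// ltW.
rewrite -[leLHS]/((2 ^+ n * l * (2 * (C * e ^+ n) + e ^+ n * K * t))%:E).
rewrite -EFinM lee_fin.
have Kt : K * t <= 2 * (C + 1).
  rewrite /t mulrA ler_pdivrMr ?ltr_wpDl// mulrC ler_wpM2l ?lerDl//.
  by rewrite mulr_ge0// addr_ge0.
have H : 2 * C + K * t <= 4 * (C + 1).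
  rewrite (_ : 4 * (C + 1) = 2 * (C + 1) + 2 * (C + 1)); last by ring.
  by apply: lerD => //; rewrite ler_pM2l// lerDl.
apply: (@le_trans _ _ (2 ^+ n * l * (4 * (C + 1) * e ^+ n))).
  apply: ler_wpM2l; first by rewrite mulr_ge0 ?exprn_ge0// ltW.
  rewrite (_ : _ + _ = (2 * C + K * t) * e ^+ n); last by ring.
  by rewrite ler_pM2r.
rewrite mulrA ler_pM2r// /l /E !exprS le_eqVlt; apply/orP; left; apply/eqP.
have n2 : 2 ^+ n != 0 :> R by rewrite expf_neq0.
have C1 : C + 1 != 0 by rewrite gt_eqF// ltr_wpDl.
by field; rewrite n2 C1.
Qed.

(** * From the profile to the maximal operator *)

Lemma kernel_profile_of_derivable (R : realType) (n : nat) (phi : R -> R)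
    (B : R) :
  (forall t, 0 < t -> 0 <= phi t) ->
  (forall t, 0 < t -> derivable phi t 1) ->
  (forall t, 0 < t -> `|derive1 phi t| <= B / t ^+ n.+1) ->
  kernel_profile n B (fun t => if 0 < t then phi t else 0).
Proof.
move=> phi_ge0 dphi phi_B; set psi := fun t => _.
have phi_cont t : 0 < t -> {for t, continuous phi}.
  by move=> t0; apply/differentiable_continuous/derivable1_diffP/dphi.
have psiE t : 0 < t -> psi t = phi t by rewrite /psi => ->.
split.
- by move=> t; rewrite /psi; case: ifPn => [/phi_ge0|].
- by rewrite /psi ltxx.
- move=> t t0; rewrite /prop_for /continuous_at psiE//.
  apply: cvg_trans (phi_cont _ t0); apply: near_eq_cvg.
  near=> y; rewrite psiE//; near: y.
  exact: lt_nbhsr.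
- have psi_restrict : psi = phi \_ `]0, +oo[%classic.
    apply/funext => t; rewrite patchE /psi; case: ifPn => t0.
      by rewrite mem_set//= in_itv/= t0.
    by rewrite memNset//= in_itv/= andbT; exact/negP.
  rewrite psi_restrict.
  apply/(measurable_restrictT (phi : measurableTypeR R -> R)) => //.
  apply: open_continuous_measurable_fun; first exact: interval_open.
  by move=> t; rewrite inE/= in_itv/= andbT; exact: phi_cont.
- move=> s t s0; rewrite le_eqVlt => /predU1P[<-|st].
    by rewrite !subrr normr0 mulr0 mul0r.
  have t0 := lt_trans s0 st.
  have [c] : exists2 c, c \in `]s, t[ & phi t - phi s = derive1 phi c * (t - s).
    apply: MVT => //.
      move=> c; rewrite in_itv/= => /andP[sc _].
      by rewrite derive1E; apply: derivableP; apply: dphi; exact: lt_trans sc.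
    apply: derivable_within_continuous => c; rewrite in_itv/= => /andP[sc _].
    by apply: dphi; exact: lt_le_trans sc.
  rewrite in_itv/= => /andP[sc _] E; rewrite !psiE// distrC E normrM.
  have c0 := lt_trans s0 sc.
  have B0 : 0 <= B.
    have := le_trans (normr_ge0 _) (phi_B _ c0).
    by rewrite pmulr_lge0// invr_gt0 exprn_gt0.
  rewrite (gtr0_norm (_ : 0 < t - s)) ?subr_gt0// mulrAC.
  rewrite ler_wpM2r ?subr_ge0 ?(ltW st)// (le_trans (phi_B _ c0))//.
  rewrite ler_wpM2l// lef_pV2 ?posrE ?exprn_gt0//.
  by rewrite lerXn2r ?nnegrE ?(ltW c0) ?(ltW s0)// ltW.
Unshelve. all: end_near. Qed.

Lemma set1_box (R : realType) n (x : Rn R n) :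
  [set x] = [set z | forall i, [set coord x i] (coord z i)].
Proof.
apply/seteqP; split => [z -> //|z /= zx].
exact: (@eq_from_tnth n R z x).
Qed.

Lemma lebesgueRn_set1 (R : realType) n (x : Rn R n) : (0 < n)%N ->
  lebesgueRn n [set x] = 0%E.
Proof.
move=> n0; rewrite set1_box (@lebesgueRn_box _ _ (fun i => [set coord x i]))//.
by rewrite (bigD1 (Ordinal n0))//= lebesgue_measure_set1 mul0e.
Qed.

Lemma measurable_set1_Rn (R : realType) n (x : Rn R n) : measurable [set x].
Proof.
by rewrite set1_box; apply: (@measurable_box _ _ (fun i => [set coord x i])).
Qed.

(** The two integrands differ at most at z = x. *)
Lemma integral_kernel_eq (R : realType) n (n0 : (0 < n)%N) (phi psi : R -> R)
    (f : Rn R n -> R) (x : Rn R n) (e : R) :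
  0 < e -> measurable_fun setT psi -> measurable_fun setT f ->
  (forall t, 0 < t -> phi t = psi t) ->
  (\int[lebesgueRn n]_z (phi (dist x z / e) * f z)%:E =
   \int[lebesgueRn n]_z (psi (dist x z / e) * f z)%:E)%E.
Proof.
move=> e0 mpsi mf phipsi.
have mk := measurable_kernel x e mpsi.
have off z : z != x -> phi (dist x z / e) = psi (dist x z / e).
  move=> zx; rewrite phipsi// divr_gt0// lt_neqAle dist_ge0 andbT.
  by apply/eqP => /esym/dist_eq0 xz; rewrite xz eqxx in zx.
have phiE : (fun z => phi (dist x z / e)) = (fun z => psi (dist x z / e) +
    (phi 0 - psi 0) * \1_[set x] z).
  apply/funext => z; have [->|zx] := eqVneq z x.
    rewrite (_ : dist x x = 0) ?mul0r ?indicE ?mem_set ?mulr1 1?addrC ?subrK//.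
    by rewrite /Defs.dist big1 ?sqrtr0// => i _; rewrite subrr expr0n.
  by rewrite off// indicE memNset ?mulr0 ?addr0//; apply/eqP.
have mphi : measurable_fun setT (fun z => phi (dist x z / e)).
  rewrite phiE; apply: (measurable_funD mk).
  apply: (measurable_funM (measurable_cst _)).
  exact: (measurable_indic (measurable_set1_Rn x)).
have m1 : measurable_fun setT (fun z => (phi (dist x z / e) * f z)%:E).
  by apply/measurable_EFinP; exact: (measurable_funM mphi mf).
have m2 : measurable_fun setT (fun z => (psi (dist x z / e) * f z)%:E).
  by apply/measurable_EFinP; exact: (measurable_funM mk mf).
apply: (ae_eq_integral _ _ measurableT m1 m2).
exists [set x]; split; [exact: measurable_set1_Rn|exact: lebesgueRn_set1|].
by move=> z /= nz; apply: contrapT => /eqP zx; apply: nz => _; rewrite off.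
Qed.

(** For an arbitrary nonnegative g the integral is a supremum over the simple
    functions below g, hence monotone in g. This avoids showing that an
    average over R^n depends measurably on the random scale. *)
Lemma integral_le_bound (d : measure_display) (T : measurableType d)
    (R : realType) (P : probability T R) (g : T -> \bar R) (b : R) :
  (forall w, (0 <= g w <= b%:E)%E) -> (\int[P]_w g w <= b%:E)%E.
Proof.
move=> gb.
have g0 w : (0 <= g w)%E by have /andP[] := gb w.
have b0 w : (0 <= (cst b%:E : T -> \bar R) w)%E.
  by have /andP[] := gb w; exact: le_trans.
rewrite -[leRHS]mule1 -(@probability_setT _ _ _ P) -integral_cst//.
rewrite ge0_integralTE// ge0_integralTE//.
apply: ereal_sup_le => _ [k /= kg <-]; exists k => //= w.
by apply: (le_trans (kg w)); have /andP[] := gb w.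
Qed.

Theorem theorem3p3 (R : realType) (n : nat) (n_ge1 : (1 <= n)%N)
  (phi : R -> R)
  (phi_ge0 : forall rho : R, 0 < rho -> 0 <= phi rho)
  (phi_derivable : forall rho : R, 0 < rho -> derivable phi rho 1)
  (phi_C1 : forall rho : R, 0 < rho -> {for rho, continuous (derive1 phi)})
  (phi_int : (\int[lebesgue_measure]_(rho in `]0%R, +oo[)
                (rho ^+ n.-1 * phi rho)%:E < +oo)%E)
  (B : R)
  (phi_B : forall rho : R, 0 < rho -> `|derive1 phi rho| <= B / rho ^+ n.+1)
  (d : measure_display) (Omega : measurableType d) (P : probability Omega R)
  (eps : nat -> {RV P >-> R})
  (nu : nat -> probability R R)
  (eps_gt0 : forall j, (1 <= j)%N -> forall w : Omega, 0 < eps j w)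
  (eps_nu : forall j, (1 <= j)%N ->
     forall E : set R, measurable E ->
       distribution P (eps j) E = nu j E) :
  weak_type11 (maximal_operator (n := n) P phi eps).
Proof.
pose psi t := if 0 < t then phi t else 0.
have psiP : kernel_profile n B psi.
  exact: kernel_profile_of_derivable phi_ge0 phi_derivable phi_B.
have [psi_ge0 psi0 psi_cont mpsi _] := psiP.
have B0 : 0 <= B.
  by have := le_trans (normr_ge0 _) (phi_B 1 ltr01); rewrite expr1n divr1.
set J := (\int[lebesgue_measure]_(rho in _) _)%E in phi_int.
have JE : (\int[lebesgue_measure]_(t in `]0%R, +oo[)
    (t ^+ n.-1 * psi t)%:E)%E = J.
  apply: eq_integral => t; rewrite inE/= in_itv/= andbT => t0.
  by rewrite /psi t0.
have J0 : (0 <= J)%E.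
  apply: integral_ge0 => t /=; rewrite in_itv/= andbT => t0.
  by rewrite lee_fin mulr_ge0 ?phi_ge0// exprn_ge0// ltW.
have J_fin : J = (fine J)%:E by rewrite fineK// ge0_fin_numE.
pose C := n%:R * ball_volume R n * fine J.
have C0 : 0 <= C by rewrite !mulr_ge0 ?ball_volume_ge0 ?fine_ge0.
have psi_int (x : Rn R n) (e : R) : 0 < e ->
    (\int[lebesgueRn n]_z (psi (dist x z / e))%:E <= (C * e ^+ n)%:E)%E.
  move=> e0; apply: (le_trans
    (integral_radial_le n_ge1 psi_ge0 psi0 psi_cont mpsi x e0)).
  by rewrite JE J_fin -EFinM lee_fin /C mulrAC.
have [A A0 weak] := dilation_maximal_weak_type n_ge1 B0 C0 psiP psi_int.
exists A => // lambda lambda0 f /Lfun1_integrable f_int.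
have mf : measurable_fun setT f.
  by apply/measurable_EFinP; exact: (measurable_int _ f_int).
have mnf : measurable_fun setT (fun z => `|f z|) by exact: measurableT_comp.
have f_fin : (\int[lebesgueRn n]_z (`|f z|)%:E < +oo)%E.
  by have /integrableP[_] := f_int.
have [U U_le U_bound] := weak lambda (fun z => `|f z|) lambda0
  (fun z => normr_ge0 _) mnf f_fin.
rewrite Lnorm1; apply: le_trans U_le.
apply: le_outer_measure => x /= lambda_lt; apply: contrapT => xU.
move: lambda_lt; apply/negP; rewrite -leNgt.
apply: ge_ereal_sup => _ [j /= j1 <-].
apply: integral_le_bound => w; have e0 := eps_gt0 j j1 w.
rewrite (integral_kernel_eq n_ge1 x e0 mpsi mnf (psi := psi)); last first.
  by move=> t t0; rewrite /psi t0.
rewrite U_bound// andbT mule_ge0 ?lee_fin ?invr_ge0 ?exprn_ge0 ?(ltW e0)//.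
by apply: integral_ge0 => z _; rewrite lee_fin mulr_ge0.
Qed.
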